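(* With the notation of the context, $$T^{\oplus}=T'\exp(-T_{\mathrm{not}\oplus}),\qquad T^{\ominus}_{\mathrm{not}\oplus}=\frac{T^{\oplus}}{\exp(T_{\mathrm{not}\oplus})},\qquad T^{\oplus}_{\mathrm{not}\oplus}=\frac{T^{\oplus}-1}{\exp(T_{\mathrm{not}\oplus})}.$$
   Context: $\mathcal P$ is a set of prime labeled graphs (at least 3 vertices, only trivial modules) stable under relabeling. $\mathcal T_{\mathcal P}$ is the set of modular decomposition trees (rooted non-plane trees with leaves labeled bijectively by $\{1,\dots,n\}$, internal nodes decorated by $\oplus$ or $\ominus$ with at least 2 children, or by a prime graph $H\in\mathcal P$ with $|H|$ children ordered by minimal leaf label, no $\oplus$-node having a $\oplus$-child and no $\ominus$-node a $\ominus$-child). $T$, $T_{\mathrm{not}\oplus}$ are the exponential generating functions by number of leaves of $\mathcal T_{\mathcal P}$ and of its trees whose root is not $\oplus$. Blossoming of $t\in\mathcal T_{\mathcal P}$ at a leaf $\ell$: for each prime-decorated node on the path from the root to $\ell$, the vertex of its decoration corresponding to the subtree containing $\ell$ is relabeled $*$ and the other labels reduced preserving order; then $\ell$ is relabeled $*$ (the blossom) and the remaining leaf labels reduced. A blossomed tree is a tree so obtained; its size is its number of non-blossom leaves. A blossom is $\oplus$-replaceable (resp. $\ominus$-replaceable) if its parent is not decorated $\oplus$ (resp. $\ominus$) (in particular if the blossom is the whole tree). $T^{\oplus}$ is the exponential generating function of blossomed trees with $\oplus$-replaceable blossom; $T^{\ominus}_{\mathrm{not}\oplus}$ that of blossomed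 trees whose root is not $\oplus$ and whose blossom is $\ominus$-replaceable; $T^{\oplus}_{\mathrm{not}\oplus}$ that of blossomed trees whose root is not $\oplus$ and whose blossom is $\oplus$-replaceable, with the convention that the tree reduced to a single blossom is excluded (so $T^{\oplus}_{\mathrm{not}\oplus}(0)=0$), while it is included in the other two series (constant term $1$). *)

(* Defs.v *)
From HB Require Import structures.
From mathcomp Require Import all_boot all_order all_algebra all_fingroup.
From mathcomp Require Import finmap.
From mathcomp Require Import boolp classical_sets functions cardinality.

Set Implicit Arguments.
Unset Strict Implicit.
Unset Printing Implicit Defensive.

Import GRing.Theory.
Local Open Scope ring_scope.
Local Open Scope classical_set_scope.

(** * Formal power series over rat *)

(* A record rather than [nat -> rat], whose canonical ring structure is the
   pointwise one. *)
Record fps := FPS { coeff :> nat -> rat }.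

Lemma fpsP (f g : fps) : f =1 g -> f = g.
Proof. by case: f g => [f] [g] /= /funext ->. Qed.

HB.instance Definition _ := gen_eqMixin fps.
HB.instance Definition _ := gen_choiceMixin fps.

Definition fps_zero := FPS (fun=> 0).
Definition fps_opp (f : fps) := FPS (fun n => - f n).
Definition fps_add (f g : fps) := FPS (fun n => f n + g n).
Definition fps_one := FPS (fun n => (n == 0%N)%:R).
Definition fps_mul (f g : fps) := FPS (fun n => \sum_(i < n.+1) f i * g (n - i)%N).

Lemma fps_addA : associative fps_add.
Proof. by move=> f g h; apply: fpsP => n /=; rewrite addrA. Qed.
Lemma fps_addC : commutative fps_add.
Proof. by move=> f g; apply: fpsP => n /=; rewrite addrC. Qed.
Lemma fps_add0 : left_id fps_zero fps_add.
Proof. by move=> f; apply: fpsP => n /=; rewrite add0r. Qed.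
Lemma fps_addN : left_inverse fps_zero fps_opp fps_add.
Proof. by move=> f; apply: fpsP => n /=; rewrite addNr. Qed.

HB.instance Definition _ :=
  GRing.isZmodule.Build fps fps_addA fps_addC fps_add0 fps_addN.

(* Truncations, used to transport the ring axioms from {poly rat}. *)
Definition fps_trunc N (f : fps) : {poly rat} := \poly_(i < N) f i.

Lemma fps_mul_trunc N (f g : fps) n : (n < N)%N ->
  fps_mul f g n = (fps_trunc N f * fps_trunc N g)`_n.
Proof.
move=> nN; rewrite coefM /=; apply: eq_bigr => i _; rewrite !coef_poly.
rewrite (leq_ltn_trans _ nN) ?(leq_ltn_trans _ nN) ?leq_subr //.
by rewrite -ltnS.
Qed.

Lemma fps_mulC : commutative fps_mul.
Proof.
by move=> f g; apply: fpsP => n; rewrite !(@fps_mul_trunc n.+1) // mulrC.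
Qed.

Lemma fps_mulA : associative fps_mul.
Proof.
move=> f g h; apply: fpsP => n.
have lt_i (i : 'I_n.+1) : (n - i < n.+1)%N by rewrite ltnS leq_subr.
transitivity (fps_trunc n.+1 f * (fps_trunc n.+1 g * fps_trunc n.+1 h))`_n.
  rewrite coefM; apply: eq_bigr => i _.
  by rewrite (fps_mul_trunc g h (lt_i i)) coef_poly ltn_ord.
rewrite mulrA coefM; apply: eq_bigr => i _.
by rewrite (fps_mul_trunc f g (ltn_ord i)) [in LHS]coef_poly lt_i.
Qed.

Lemma fps_mul1 : left_id fps_one fps_mul.
Proof.
move=> f; apply: fpsP => n /=; rewrite big_ord_recl /= mul1r subn0.
by rewrite big1 ?addr0 // => i _; rewrite mul0r.
Qed.

Lemma fps_mulDl : left_distributive fps_mul fps_add.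
Proof.
move=> f g h; apply: fpsP => n /=; rewrite -big_split /=.
by apply: eq_bigr => i _; rewrite mulrDl.
Qed.

Lemma fps_one_neq0 : fps_one != fps_zero.
Proof. by apply/eqP => /(congr1 (fun f : fps => f 0%N)). Qed.

HB.instance Definition _ := GRing.Zmodule_isComNzRing.Build fps
  fps_mulA fps_mulC fps_mul1 fps_mulDl fps_one_neq0.

Lemma coeffD (f g : fps) n : (f + g) n = f n + g n. Proof. by []. Qed.
Lemma coeffN (f : fps) n : (- f) n = - f n. Proof. by []. Qed.
Lemma coeff0 n : (0 : fps) n = 0. Proof. by []. Qed.
Lemma coeff1 n : (1 : fps) n = (n == 0%N)%:R. Proof. by []. Qed.
Lemma coeffM (f g : fps) n : (f * g) n = \sum_(i < n.+1) f i * g (n - i)%N.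
Proof. by []. Qed.

Lemma coeff_sum (I : Type) (r : seq I) (P : pred I) (F : I -> fps) n :
  (\sum_(i <- r | P i) F i) n = \sum_(i <- r | P i) F i n.
Proof. by apply: (big_morph (fun f : fps => f n)). Qed.

Lemma coeffX_eq0 (f : fps) k n : f 0%N = 0 -> (n < k)%N -> (f ^+ k) n = 0.
Proof.
move=> f0; elim: k n => // k IH n lt_nk.
rewrite exprS coeffM big_ord_recl f0 mul0r add0r big1 // => i _.
rewrite IH ?mulr0 // lift0; apply: leq_trans (_ : n <= k)%N => //.
by rewrite ltn_subrL /= (leq_ltn_trans (leq0n i) (ltn_ord i)).
Qed.

Definition fps_unit : pred fps := fun f => f 0%N != 0.

(* 1 - f / f(0), which has zero constant term when f(0) != 0. *)
Definition fps_red (f : fps) := FPS (fun n => (n == 0%N)%:R - (f 0%N)^-1 * f n).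

(* 1 / f = f(0)^-1 \sum_k (1 - f / f(0))^k; the terms with k > n do not
   contribute to the coefficient of order n. *)
Definition fps_inv (f : fps) : fps :=
  if fps_unit f then
    FPS (fun n => (f 0%N)^-1 * \sum_(k < n.+1) (fps_red f ^+ k) n)
  else f.

Lemma fps_mulV : {in fps_unit, left_inverse 1 fps_inv *%R}.
Proof.
move=> f uf; rewrite mulrC /fps_inv ifT //; apply: fpsP => n.
have f0 : f 0%N != 0 by [].
set u := fps_red f.
have u0 : u 0%N = 0 by rewrite /= mulVf // subrr.
transitivity (((1 - u) * \sum_(k < n.+1) u ^+ k) n).
  rewrite !coeffM; apply: eq_bigr => i _.
  rewrite coeffD coeffN coeff1 /= opprB addrC subrK coeff_sum.
  rewrite mulrCA mulrA; congr (_ * _).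
  have le_n : ((n - i).+1 <= n.+1)%N by rewrite ltnS leq_subr.
  rewrite (big_ord_widen _ (fun k => (u ^+ k) (n - i)%N) le_n).
  rewrite [RHS](bigID (fun k : 'I_n.+1 => (k < (n - i).+1)%N)) /=.
  rewrite [X in _ = _ + X]big1 ?addr0 // => k; rewrite -leqNgt => lt_k.
  by rewrite coeffX_eq0.
have := subrXX_comm n.+1 (commr_sym (commr1 u)); rewrite expr1n.
under eq_bigr => k _ do rewrite expr1n mul1r.
by move=> <-; rewrite coeffD coeffN coeffX_eq0 // oppr0 addr0.
Qed.

Lemma fps_unitP (f g : fps) : g * f = 1 -> fps_unit f.
Proof.
move=> /(congr1 (fun h : fps => h 0%N)); rewrite coeffM big_ord1 subn0 coeff1.
by move=> gf; apply/eqP => f0; move: gf; rewrite f0 mulr0 => /eqP.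
Qed.

Lemma fps_inv_out : {in [predC fps_unit], fps_inv =1 id}.
Proof. by move=> f; rewrite inE => /negbTE nu; rewrite /fps_inv [fps_unit f]nu. Qed.

HB.instance Definition _ :=
  GRing.ComNzRing_hasMulInverse.Build fps fps_mulV fps_unitP fps_inv_out.

Definition fps_deriv (f : fps) : fps := FPS (fun n => n.+1%:R * f n.+1).

(* The composition exp(f) = \sum_k f^k / k!, meaningful when f(0) = 0: then the
   terms with k > n do not contribute to the coefficient of order n. *)
Definition fps_exp (f : fps) : fps :=
  FPS (fun n => \sum_(k < n.+1) (f ^+ k) n / k`!%:R).

(* [fset_set] is empty on infinite sets; the sets counted below are finite when
   every graph of P is prime, since internal nodes have at least 2 children. *)
Definition egf (T : choiceType) (size : T -> nat) (A : set T) : fps :=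
  FPS (fun n => #|` fset_set [set t | A t /\ size t = n]|%:R / n`!%:R).

(** * Labeled graphs *)

Definition is_sgraph (V : finType) (e : {ffun V * V -> bool}) : bool :=
  [forall x, ~~ e (x, x)] && [forall x, forall y, e (x, y) == e (y, x)].

Record sgraph (V : finType) :=
  SGraph { edges : {ffun V * V -> bool}; edgesP : is_sgraph edges }.

HB.instance Definition _ (V : finType) := [isSub for @edges V].
HB.instance Definition _ (V : finType) := [Finite of sgraph V by <:].

Definition adj (V : finType) (G : sgraph V) : rel V := fun x y => edges G (x, y).

Lemma pullback_subproof (V W : finType) (f : W -> V) (G : sgraph V) :
  is_sgraph [ffun p => adj G (f p.1) (f p.2)].
Proof.
have /andP[/forallP irr /forallP sym] := edgesP G.
apply/andP; split; first by apply/forallP => x; rewrite ffunE; exact: irr.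
by apply/forallP => x; apply/forallP => y; rewrite !ffunE; have /forallP/(_ (f y)) := sym (f x).
Qed.

(* x and y are adjacent iff f x and f y are: a relabeling when f is bijective. *)
Definition pullback (V W : finType) (f : W -> V) (G : sgraph V) : sgraph W :=
  SGraph (pullback_subproof f G).

Definition is_module (V : finType) (G : sgraph V) (M : {set V}) : Prop :=
  forall x y z, x \in M -> y \in M -> z \notin M -> adj G x z = adj G y z.

Definition prime_graph (V : finType) (G : sgraph V) : Prop :=
  (3 <= #|V|)%N /\
  forall M : {set V}, is_module G M ->
    [\/ M = finset.set0, exists x, M = [set x]%SET | M = [set: V]%SET].

(* Labeled graphs with at least one vertex; [existT _ k G] has the k.+1 vertices
   0, .., k, standing for the labels 1, .., k.+1. *)
Definition lgraph := {k : nat & sgraph 'I_k.+1}.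

Definition lgraph_size (H : lgraph) : nat := (tag H).+1.

Definition relabeling_stable (P : set lgraph) : Prop :=
  forall k (G : sgraph 'I_k.+1) (s : 'S_k.+1),
    P (existT _ k G) -> P (existT _ k (pullback s G)).

(* Graphs with one vertex labeled * (encoded by None), the k other ones being
   labeled as above. *)
Definition star_graph := {k : nat & sgraph (option 'I_k)}.

(* [lift i] is the increasing bijection from 'I_k to the vertices other than i. *)
Definition unstar k (i : 'I_k.+1) (x : option 'I_k) : 'I_k.+1 :=
  if x is Some j then lift i j else i.

Definition star (H : lgraph) (i : nat) : star_graph :=
  existT _ (tag H) (pullback (unstar (inord i)) (tagged H)).

(** * Modular decomposition trees *)

Inductive decoration (G : Type) := Oplus | Ominus | Prime of G.
Arguments Oplus {G}.
Arguments Ominus {G}.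

Definition is_oplus G (d : decoration G) := if d is Oplus then true else false.
Definition is_ominus G (d : decoration G) := if d is Ominus then true else false.

(* A non-plane tree with distinct leaf labels is represented by its plane
   embedding in which the children of every internal node are ordered by minimal
   leaf label (see [canonical]).  The i-th child of a prime node corresponds to
   the i-th vertex of the decoration. *)
Inductive tree :=
  | Leaf of nat
  | Node of decoration lgraph & seq tree.

HB.instance Definition _ := gen_eqMixin tree.
HB.instance Definition _ := gen_choiceMixin tree.

Fixpoint leaves (t : tree) : seq nat :=
  match t with
  | Leaf l => [:: l]
  | Node _ ts => flatten (map leaves ts)
  end.

Definition tsize (t : tree) : nat := size (leaves t).

Definition min_leaf (t : tree) : nat :=
  foldr minn (head 0%N (leaves t)) (leaves t).

Definition root_oplus (t : tree) := if t is Node d _ then is_oplus d else false.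
Definition root_ominus (t : tree) := if t is Node d _ then is_ominus d else false.

Fixpoint canonical (P : set lgraph) (t : tree) : bool :=
  match t with
  | Leaf _ => true
  | Node d ts =>
      [&& match d with
          | Oplus => (2 <= size ts)%N && ~~ has root_oplus ts
          | Ominus => (2 <= size ts)%N && ~~ has root_ominus ts
          | Prime H => (H \in P) && (size ts == lgraph_size H)
          end,
          sorted ltn (map min_leaf ts)
        & all (canonical P) ts]
  end.

Definition md_tree (P : set lgraph) : set tree :=
  [set t | canonical P t /\ perm_eq (leaves t) (iota 1 (tsize t))].

Definition T (P : set lgraph) : fps := egf tsize (md_tree P).

Definition T_notoplus (P : set lgraph) : fps :=
  egf tsize [set t | md_tree P t /\ ~~ root_oplus t].

(** * Blossomed trees *)

(* [BNode d b ts] is an internal node on the path from the root to the blossom: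
   b is the child containing the blossom and ts are the other children, ordered
   by minimal leaf label.  If d = Prime H, then b corresponds to the vertex * of
   H and the i-th tree of ts to the i-th other vertex. *)
Inductive btree :=
  | Blossom
  | BNode of decoration star_graph & btree & seq tree.

HB.instance Definition _ := gen_eqMixin btree.
HB.instance Definition _ := gen_choiceMixin btree.

Fixpoint map_leaves (f : nat -> nat) (t : tree) : tree :=
  match t with
  | Leaf l => Leaf (f l)
  | Node d ts => Node d (map (map_leaves f) ts)
  end.

Definition star_decoration (d : decoration lgraph) (i : nat) :
    decoration star_graph :=
  match d with
  | Oplus => Oplus
  | Ominus => Ominus
  | Prime H => Prime (star H i)
  end.

(* The blossoming of t at its leaf labeled l.  [unbump l] is the increasing
   bijection from {1, .., n} minus l to {1, .., n - 1}. *)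
Fixpoint blossoming (l : nat) (t : tree) : btree :=
  match t with
  | Leaf _ => Blossom
  | Node d ts =>
      let i := find (fun u => l \in leaves u) ts in
      BNode (star_decoration d i)
            (nth Blossom (map (blossoming l) ts) i)
            (map (map_leaves (unbump l)) (take i ts ++ drop i.+1 ts))
  end.

Definition blossomed (P : set lgraph) : set btree :=
  [set b | exists t l, [/\ md_tree P t, l \in leaves t & b = blossoming l t]].

Fixpoint bsize (b : btree) : nat :=
  match b with
  | Blossom => 0
  | BNode _ b' ts => (bsize b' + \sum_(t <- ts) tsize t)%N
  end.

Definition broot_oplus (b : btree) :=
  if b is BNode d _ _ then is_oplus d else false.

Fixpoint blossom_parent (b : btree) : option (decoration star_graph) :=
  match b with
  | Blossom => None
  | BNode d Blossom _ => Some d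
  | BNode _ b' _ => blossom_parent b'
  end.

Definition oplus_replaceable (b : btree) : bool :=
  if blossom_parent b is Some d then ~~ is_oplus d else true.

Definition ominus_replaceable (b : btree) : bool :=
  if blossom_parent b is Some d then ~~ is_ominus d else true.

(* In the names below, the superscript comes first: [Toplus_notoplus] is
   T^{oplus}_{not oplus}. *)
Definition Toplus (P : set lgraph) : fps :=
  egf bsize [set b | blossomed P b /\ oplus_replaceable b].

Definition Tominus_notoplus (P : set lgraph) : fps :=
  egf bsize
    [set b | [/\ blossomed P b, ~~ broot_oplus b & ominus_replaceable b]].

Definition Toplus_notoplus (P : set lgraph) : fps :=
  egf bsize
    [set b | [/\ blossomed P b, ~~ broot_oplus b, oplus_replaceable b
               & b <> Blossom]].

(* Main.v *)
(** Blossoming at the leaf labeled 1 is a bijection from the trees with n + 1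
    leaves onto the blossomed trees of size n (relabeling-stability of P is what
    makes blossoming at any other leaf give nothing new), so each series of
    blossomed trees is the derivative of a series of trees constrained along
    the path to their smallest, i.e. leftmost, leaf.

    Let E be the series of forests, i.e. of sets of trees whose root is not
    oplus.  Extracting the tree which contains the smallest label gives
    E' = T_notoplus' E, hence E = exp(T_notoplus).  Three identities follow by
    detaching a possibly empty forest: from an oplus parent of the smallest
    leaf, T' = Toplus E; from an oplus root,
    Tominus = Tominus_notoplus E and Toplus - 1 = Toplus_notoplus E.  Exchanging
    oplus and ominus gives Tominus = Toplus. *)

Require Import Defs.
From mathcomp Require Import all_boot all_order all_algebra all_fingroup.
From mathcomp Require Import finmap zify.
From mathcomp Require Import boolp classical_sets functions cardinality.
Import Defs.

Set Implicit Arguments.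
Unset Strict Implicit.
Unset Printing Implicit Defensive.

Import GRing.Theory.

(** * Formal power series *)

Section FormalPowerSeries.
Local Open Scope ring_scope.
Implicit Types f g : fps.

Lemma fps_derivM f g :
  fps_deriv (f * g) = fps_deriv f * g + f * fps_deriv g.
Proof.
apply: fpsP => n; rewrite coeffD !coeffM.
(* The factor [n.+1] is split as [i + (n.+1 - i)], one summand for each differentiated factor. *)
transitivity (\sum_(i < n.+2) (i%:R * f i * g (n.+1 - i)%N
                               + (n.+1 - i)%:R * f i * g (n.+1 - i)%N)).
  rewrite /= mulr_sumr; apply: eq_bigr => i _.
  have le_i : (i <= n.+1)%N by rewrite -ltnS.
  by rewrite -2!mulrDl -natrD (subnKC le_i) mulrA.
rewrite big_split /=; congr (_ + _).
  rewrite big_ord_recl /= !mul0r add0r; apply: eq_bigr => i _ /=.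
  by rewrite /bump /= add1n subSS.
rewrite big_ord_recr /= subnn !mul0r addr0; apply: eq_bigr => i _ /=.
have le_i : (i <= n)%N by rewrite -ltnS.
by rewrite (subSn le_i) -mulrA mulrCA.
Qed.

Lemma fps_derivX f k : fps_deriv (f ^+ k.+1) = fps_deriv f * f ^+ k *+ k.+1.
Proof.
elim: k => [|k IH]; first by rewrite expr0 expr1 mulr1.
by rewrite exprS fps_derivM IH mulrnAr mulrCA -exprS [in RHS]mulrS.
Qed.

Lemma fps_deriv_eq0 f : fps_deriv f = 0 -> f 0%N = 1 -> f = 1.
Proof.
move=> df f0; apply: fpsP => -[|n]; first by rewrite f0.
move/(congr1 (fun h : fps => h n)): df => /= /eqP.
by rewrite mulf_eq0 Num.Theory.pnatr_eq0 /= => /eqP.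
Qed.

(** [f ^+ k] has no term of order below [k]. A bound common to all coefficients is what allows the
    sums to be exchanged in [fps_deriv_exp]. *)
Lemma fps_exp_trunc f N n : f 0%N = 0 -> (n < N)%N ->
  fps_exp f n = \sum_(k < N) (f ^+ k) n / k`!%:R.
Proof.
move=> f0 nN; rewrite /= (big_ord_widen _ (fun k => (f ^+ k) n / k`!%:R) nN).
rewrite [RHS](bigID (fun k : 'I_N => (k < n.+1)%N)) /=.
rewrite [X in _ = _ + X]big1 ?addr0 // => k; rewrite -leqNgt => lt_k.
by rewrite coeffX_eq0 // mul0r.
Qed.

Lemma coeffMn f k n : (f *+ k) n = f n *+ k.
Proof. by elim: k => // k IH; rewrite !mulrS coeffD IH. Qed.

Lemma fps_exp0 f : fps_exp f 0%N = 1.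
Proof. by rewrite /= big_ord1 expr0 divr1. Qed.

Lemma fps_deriv_exp f : f 0%N = 0 ->
  fps_deriv (fps_exp f) = fps_deriv f * fps_exp f.
Proof.
move=> f0; apply: fpsP => n; rewrite coeffM.
transitivity (\sum_(k < n.+1) (fps_deriv f * f ^+ k) n / k`!%:R).
  rewrite /fps_deriv /= big_ord_recl /= mul0r add0r mulr_sumr.
  apply: eq_bigr => k _ /=; rewrite mulrA.
  have -> : n.+1%:R * (f ^+ k.+1) n.+1 = fps_deriv (f ^+ k.+1) n by [].
  rewrite fps_derivX coeffMn factS natrM invfM mulrA -[_ *+ k.+1]mulr_natr.
  by rewrite mulfK // Num.Theory.pnatr_eq0.
under eq_bigr => k _ do rewrite coeffM mulr_suml.
rewrite exchange_big; apply: eq_bigr => i _.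
have lt_n : (n - i < n.+1)%N by rewrite ltnS leq_subr.
rewrite (fps_exp_trunc f0 lt_n) mulr_sumr.
by apply: eq_bigr => k _; rewrite mulrA.
Qed.

Lemma fps_derivN f : fps_deriv (- f) = - fps_deriv f.
Proof. by apply: fpsP => n /=; rewrite mulrN. Qed.

(** Integrating factor: the derivative of [g * fps_exp (- f)] vanishes and its constant term is
    1. *)
Lemma fps_exp_unique f g : f 0%N = 0 -> g 0%N = 1 ->
  fps_deriv g = fps_deriv f * g -> g * fps_exp (- f) = 1.
Proof.
move=> f0 g0 dg; have Nf0 : (- f) 0%N = 0 by rewrite coeffN f0 oppr0.
apply: fps_deriv_eq0; last by rewrite coeffM big_ord1 g0 fps_exp0 mulr1.
rewrite fps_derivM dg fps_deriv_exp // fps_derivN.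
by rewrite mulNr mulrN mulrCA mulrA subrr.
Qed.

Lemma fps_expK f : f 0%N = 0 -> fps_exp f * fps_exp (- f) = 1.
Proof.
by move=> f0; rewrite fps_exp_unique ?fps_exp0 // fps_deriv_exp.
Qed.

Lemma fps_exp_eq f g : f 0%N = 0 -> g 0%N = 1 ->
  fps_deriv g = fps_deriv f * g -> g = fps_exp f.
Proof.
move=> f0 g0 dg; rewrite -[RHS]mul1r -(fps_exp_unique f0 g0 dg).
by rewrite mulrAC -mulrA fps_expK // mulr1.
Qed.

Lemma fps_invexp f : f 0%N = 0 -> (fps_exp f)^-1 = fps_exp (- f).
Proof.
move=> f0; have uf : fps_exp f \is a GRing.unit.
  by apply/unitrPr; exists (fps_exp (- f)); rewrite fps_expK.
by rewrite -[LHS]mulr1 -(fps_expK f0) mulKr.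
Qed.

End FormalPowerSeries.

(** * Labelled products of classes of trees *)

(** The children of a node form a list, so the induction is set up by hand, with a hypothesis for
    each member of the list. *)
Lemma tree_ind_seq (Q : tree -> Prop) :
  (forall l, Q (Leaf l)) ->
  (forall d ts, {in ts, forall t, Q t} -> Q (Node d ts)) ->
  forall t, Q t.
Proof.
move=> QL QN; have Q0 : {in [::], forall t, Q t} by [].
have Qcons t ts : Q t -> {in ts, forall u, Q u} -> {in t :: ts, forall u, Q u}.
  by move=> Qt Qts u; rewrite in_cons => /predU1P[->|/Qts].
fix IH 1 => -[l|d ts]; first exact: QL.
apply: QN; elim: ts => [|t ts]; first exact: Q0.
exact: Qcons (IH t).
Qed.

(** * Cardinalities of finite sets *)

Section Cardinality.
Local Open Scope classical_set_scope.

Definition ncard (T : choiceType) (A : set T) : nat := #|` fset_set A|.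

Lemma ncard_inj (T U : choiceType) (f : T -> U) (A : set T) (B : set U) :
  finite_set A -> {in A &, injective f} -> f @` A = B -> ncard B = ncard A.
Proof.
move=> finA injf <-; rewrite /ncard fset_set_image // card_in_imfset //.
by move=> x y; rewrite /= !in_fset_set // => xA yA; apply: injf.
Qed.

Lemma ncard_bij (T U : choiceType) (f : T -> U) (g : U -> T)
    (A : set T) (B : set U) :
  finite_set A -> {homo f : x / A x >-> B x} -> {homo g : y / B y >-> A y} ->
  (forall x, A x -> g (f x) = x) -> (forall y, B y -> f (g y) = y) ->
  ncard B = ncard A.
Proof.
move=> finA AB BA gf fg; apply: (ncard_inj finA (f := f)).
  move=> x y; rewrite !in_setE => Ax Ay fxy.
  by rewrite -(gf x) // fxy gf.
apply/seteqP; split=> [y [x /AB Bx <-]//|y By].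
by exists (g y); [apply: BA | apply: fg].
Qed.

Lemma ncard_uniq (T : choiceType) (A : set T) (s : seq T) :
  uniq s -> (forall x, A x <-> x \in s) -> ncard A = size s.
Proof.
move=> us As; have finA : finite_set A.
  by apply: sub_finite_set (finite_seq s) => x /As.
apply: perm_size; apply: uniq_perm => // x.
by rewrite in_fset_set //; apply/idP/idP => [|/As]; rewrite in_setE // => /As.
Qed.

Lemma finite_uniqP (T : choiceType) (A : set T) : finite_set A ->
  exists2 s, uniq s & forall x, A x <-> x \in s.
Proof.
move=> finA; exists (fset_set A) => // x.
by rewrite in_fset_set // in_setE.
Qed.

Lemma ncardX (T U : choiceType) (A : set T) (B : set U) :
  finite_set A -> finite_set B -> ncard (A `*` B) = (ncard A * ncard B)%N.
Proof.
move=> /finite_uniqP[s us As] /finite_uniqP[r ur Br].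
rewrite (ncard_uniq us As) (ncard_uniq ur Br) -(size_allpairs pair).
apply: ncard_uniq; first by rewrite allpairs_uniq // => -[x y] [].
move=> [x y]; split=> [[/As xs /Br yr]|/allpairsP[[u v] [us' vr [-> ->]]]].
  by apply/allpairsP; exists (x, y).
by split; [apply/As | apply/Br].
Qed.

Lemma ncard_fibers (T : choiceType) (I : finType) (f : T -> I) (A : set T) :
  finite_set A -> ncard A = (\sum_i ncard [set x | A x /\ f x = i])%N.
Proof.
move=> /finite_uniqP[s us As]; rewrite (ncard_uniq us As) -sum1_size.
rewrite (partition_big f predT) //=; apply: eq_bigr => i _.
rewrite sum1_count -size_filter; apply/esym/ncard_uniq; first exact: filter_uniq.
move=> x; rewrite mem_filter; split=> [[/As -> ->]|/andP[/eqP <- /As]//].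
by rewrite eqxx.
Qed.

Lemma finite_seqs (T : choiceType) (A : set T) n : finite_set A ->
  finite_set [set s : seq T | {in s, forall x, A x} /\ (size s <= n)%N].
Proof.
move=> finA; elim: n => [|n IHn].
  by apply: (sub_finite_set _ (finite_set1 [::])) => -[|x s] [].
set S := [set s | _] in IHn.
apply: (@sub_finite_set _ _
    ([set [::]] `|` (fun p => p.1 :: p.2) @` (A `*` S))).
  move=> [|x s] [As sz]; [by left | right; exists (x, s) => //; split=> /=].
    by apply: As; rewrite mem_head.
  by split=> // y ys; apply: As; rewrite in_cons ys orbT.
rewrite finite_setU; split; first exact: finite_set1.
by apply: finite_image; apply: finite_setX.
Qed.

End Cardinality.

(** * Relabeling of leaves and the smallest leaf *)

Lemma leaves_map f t : leaves (map_leaves f t) = map f (leaves t).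
Proof.
elim/tree_ind_seq: t => //= d ts IH; rewrite map_flatten -!map_comp.
by congr flatten; apply/eq_in_map => t /IH.
Qed.

Lemma map_leaves_comp f g t :
  map_leaves f (map_leaves g t) = map_leaves (f \o g) t.
Proof.
elim/tree_ind_seq: t => //= d ts IH; rewrite -map_comp.
by congr Node; apply/eq_in_map => t /IH.
Qed.

Lemma mem_leaves_Node d ts t x :
  t \in ts -> x \in leaves t -> x \in leaves (Node d ts).
Proof. by move=> tts xt; apply/flatten_mapP; exists t. Qed.

Lemma map_leaves_id f t : {in leaves t, f =1 id} -> map_leaves f t = t.
Proof.
elim/tree_ind_seq: t => [l|d ts IH] fid; first by rewrite /= fid ?mem_head.
congr Node; rewrite -[RHS]map_id; apply/eq_in_map => t tts.
by apply: IH => // x xt; apply/fid/mem_leaves_Node/xt.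
Qed.

Lemma foldr_minP x s : (foldr minn x s \in x :: s) /\
  all (leq (foldr minn x s)) (x :: s).
Proof.
elim: s => [|y s [IH1 /= /andP[IH2 IH3]]] /=; first by rewrite mem_head leqnn.
split.
  rewrite /minn; case: ifP => _; first by rewrite !in_cons eqxx orbT.
  by move: IH1; rewrite !in_cons => /orP[->|->] //; rewrite !orbT.
rewrite !geq_min IH2 leqnn orbT /=; apply/allP => z /(allP IH3) /= le_z.
by rewrite geq_min le_z orbT.
Qed.

Lemma min_leaf_in t : leaves t != [::] -> min_leaf t \in leaves t.
Proof.
rewrite /min_leaf; case: (leaves t) => //= x s _.
have [/= m1 _] := foldr_minP x s; rewrite /minn; case: ifP => _.
  exact: mem_head.
exact: m1.
Qed.

Lemma min_leaf_le t x : x \in leaves t -> min_leaf t <= x.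
Proof.
rewrite /min_leaf => xt; have [_ /allP /(_ x)] := foldr_minP (head 0 (leaves t)) (leaves t).
by apply; rewrite in_cons xt orbT.
Qed.

Lemma min_leafE t m :
  m \in leaves t -> {in leaves t, forall x, m <= x} -> min_leaf t = m.
Proof.
move=> mt m_le; apply/eqP; rewrite eqn_leq min_leaf_le // m_le //.
by apply: min_leaf_in; case: (leaves t) mt.
Qed.

Lemma min_leaf_map f t : leaves t != [::] ->
  {in leaves t &, {homo f : x y / x < y}} ->
  min_leaf (map_leaves f t) = f (min_leaf t).
Proof.
move=> t0 hf; have mt := min_leaf_in t0; apply: min_leafE.
  by rewrite leaves_map map_f.
move=> y; rewrite leaves_map => /mapP[x xt ->].
have := min_leaf_le xt; rewrite leq_eqVlt => /predU1P[->//|lt_x].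
exact/ltnW/hf.
Qed.

Section LabelledClasses.
Local Open Scope classical_set_scope.
Implicit Types (A B C : set tree) (s : seq nat).

Definition on_labels A s := [set t | A t /\ perm_eq (leaves t) s].

(** Only increasing maps are allowed, because other relabelings may break the order of children by
    minimal leaf. *)
Definition equivariant A := forall f t,
  {in leaves t &, {homo f : x y / x < y}} -> A t -> A (map_leaves f t).

(** Required for counting, as [fset_set] is empty on an infinite set. *)
Definition locally_finite A := forall s, finite_set (on_labels A s).

Definition tree_egf A : fps :=
  egf Defs.tsize [set t | A t /\ perm_eq (leaves t) (iota 1 (Defs.tsize t))].

Lemma tree_egfE A n :
  tree_egf A n = ((ncard (on_labels A (iota 1 n)))%:R / n`!%:R)%R.
Proof.
rewrite /= -/(ncard _); congr ((ncard _)%:R / _)%R; apply/seteqP; split=> t [].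
  by move=> [At pt] <-.
move=> At pt; have sz : Defs.tsize t = n by rewrite /Defs.tsize (perm_size pt) size_iota.
by split; rewrite ?sz.
Qed.

Lemma fps_deriv_tree_egfE A n :
  fps_deriv (tree_egf A) n = ((ncard (on_labels A (iota 1 n.+1)))%:R / n`!%:R)%R.
Proof.
have -> : (fps_deriv (tree_egf A) n = n.+1%:R * tree_egf A n.+1)%R by [].
rewrite tree_egfE factS natrM invfM mulrCA mulVKf //.
by rewrite Num.Theory.pnatr_eq0.
Qed.

(** Trees are transported along the increasing bijection between the two label sets. *)
Lemma ncard_on_labels A s : equivariant A -> locally_finite A -> uniq s ->
  ncard (on_labels A s) = ncard (on_labels A (iota 1 (size s))).
Proof.
move=> eqA finA us; set r := sort leq s.
have prs : perm_eq r s by rewrite perm_sort.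
have ur : uniq r by rewrite sort_uniq.
have sr : sorted leq r by apply: sort_sorted; apply: leq_total.
rewrite -(perm_size prs).
have -> : on_labels A s = on_labels A r.
  apply/seteqP; split=> t [At pt]; split=> //; apply: perm_trans pt _ => //.
  by rewrite perm_sym.
(* [f] sends a rank, counted from 1, to the label of that rank in [r], and [g] is its inverse;
   positions in [r] are counted from 0, hence the offsets. *)
pose f i := nth 0 r i.-1; pose g x := (index x r).+1.
have fE : map f (iota 1 (size r)) = r.
  apply: (@eq_from_nth _ 0); rewrite size_map size_iota // => i lt_i.
  by rewrite (nth_map 0) ?size_iota // nth_iota.
have gE : map g r = iota 1 (size r).
  apply: (@eq_from_nth _ 0); rewrite size_map ?size_iota // => i lt_i.
  by rewrite (nth_map 0) // nth_iota // /g index_uniq.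
apply: (ncard_bij (f := map_leaves f) (g := map_leaves g)) => //.
- move=> t [At pt]; split; last by rewrite leaves_map -fE perm_map.
  apply: eqA => // x y; rewrite !(perm_mem pt) !mem_iota add1n !ltnS.
  move=> /andP[x0 xr] /andP[y0 yr] lt_xy.
  have sr' : sorted ltn r by rewrite ltn_sorted_uniq_leq ur.
  by apply: (sorted_ltn_nth ltn_trans) => //; rewrite ?inE ?prednK // -ltnS !prednK.
- move=> t [At pt]; split; last by rewrite leaves_map -gE perm_map.
  apply: eqA => // x y; rewrite !(perm_mem pt) => xr yr lt_xy.
  rewrite /g ltnS ltnNge; apply/negP => le_yx; move: lt_xy; rewrite ltnNge.
  by rewrite (sorted_leq_index leq_trans leqnn sr).
- move=> t [_ pt]; rewrite map_leaves_comp map_leaves_id // => x.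
  rewrite (perm_mem pt) mem_iota add1n ltnS => /andP[x0 xr] /=.
  by rewrite /g /f index_uniq ?prednK.
- move=> t [_ pt]; rewrite map_leaves_comp map_leaves_id // => x.
  by rewrite (perm_mem pt) /= /f /g /= => /nth_index ->.
Qed.

(** The boxed product of two labelled classes. The second component may have no leaf, so the
    condition ranges over its leaves instead of using its minimum. *)
Definition pointed_pairs A B n : set (tree * tree) :=
  [set p | [/\ A p.1, B p.2, all (ltn (min_leaf p.1)) (leaves p.2)
             & perm_eq (leaves p.1 ++ leaves p.2) (iota 1 n.+1)]].

(* An element i of 'I_n stands for the label i + 2, the label 1 being forced
   into the first component of a pair. *)
Let labels n (S : {set 'I_n}) := [seq (val i).+2 | i <- enum S].

Let mem_labels n (S : {set 'I_n}) (i : 'I_n) : ((val i).+2 \in labels S) = (i \in S).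
Proof.
rewrite -mem_enum; apply: (mem_map (f := fun i : 'I_n => (val i).+2)).
by move=> x y [] /val_inj.
Qed.

Let uniq_labels n (S : {set 'I_n}) : uniq (labels S).
Proof. by rewrite map_inj_uniq ?enum_uniq // => x y [] /val_inj. Qed.

Let labels_gt1 n (S : {set 'I_n}) : {in labels S, forall x, 1 < x}.
Proof. by move=> _ /mapP[i _ ->]. Qed.

Let labelsC n (S : {set 'I_n}) :
  perm_eq ((1 :: labels S) ++ labels (~: S)) (iota 1 n.+1).
Proof.
have -> : iota 1 n.+1 = 1 :: [seq (val i).+2 | i <- enum 'I_n].
  rewrite /= (map_comp (fun i => i.+2) val) val_enum_ord.
  by congr cons; rewrite -[2]/(2 + 0) iotaDl.
rewrite /= perm_cons -map_cat perm_map //; apply: uniq_perm.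
- rewrite cat_uniq !enum_uniq andbT /=; apply/hasPn => i.
  by rewrite /= !mem_enum inE.
- exact: enum_uniq.
- by move=> i; rewrite mem_cat !mem_enum inE orbN.
Qed.

Let fiber n (p : tree * tree) := [set i : 'I_n | (val i).+2 \in leaves p.1]%SET.

(** Once the labels of the first component are fixed, the two components are chosen
    independently. *)
Lemma pointed_pairs_fiber A B n (S : {set 'I_n}) :
  (forall t, A t -> leaves t != [::]) ->
  [set p | pointed_pairs A B n p /\ fiber n p = S]
    = on_labels A (1 :: labels S) `*` on_labels B (labels (~: S)).
Proof.
move=> A0; apply/seteqP; split=> -[x y] /=.
  move=> [[/= Ax By /allP lt_xy pxy'] <-].
  have pxy : perm_eq (leaves x ++ leaves y) (iota 1 n.+1) by [].
  have xy1 : {subset leaves x ++ leaves y <= iota 1 n.+1}.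
    by move=> k; rewrite (perm_mem pxy).
  have uxy : uniq (leaves x ++ leaves y) by rewrite (perm_uniq pxy) iota_uniq.
  (* Otherwise 1 lies in [y] and the minimum of [x] is 0, which is not a label. *)
  have x1 : 1 \in leaves x.
    have : 1 \in leaves x ++ leaves y by rewrite (perm_mem pxy) mem_head.
    rewrite mem_cat => /orP[//|/lt_xy /=]; rewrite ltnS leqn0 => /eqP m0.
    have := xy1 (min_leaf x); rewrite mem_cat min_leaf_in ?A0 // m0 mem_iota.
    by move=> /(_ isT).
  have px : perm_eq (leaves x) (1 :: labels (fiber n (x, y))).
    apply: uniq_perm.
    - by move: uxy; rewrite cat_uniq => /andP[].
    - by rewrite /= uniq_labels andbT; apply/negP => /labels_gt1.
    move=> k; rewrite in_cons; apply/idP/orP => [xk|].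
      have := xy1 k; rewrite mem_cat xk mem_iota => /(_ isT).
      case: k xk => [//|[|k]] xk lt_k; [by left | right].
      rewrite add1n !ltnS /= in lt_k.
      by rewrite -[k.+2]/((val (Ordinal lt_k)).+2) mem_labels inE.
    by move=> [/eqP ->//|/mapP[i + ->]]; rewrite mem_enum inE.
  split; split=> //=.
  (* Prepending the labels of [x] to both sides reduces the claim on [y] to [labelsC]. *)
  rewrite -(perm_cat2l (leaves x)) (perm_trans pxy) // perm_sym.
  by rewrite (perm_trans _ (labelsC (fiber n (x, y)))) // perm_cat2r.
move=> [[/= Ax px] [/= By py]].
have x1 : 1 \in leaves x by rewrite (perm_mem px) mem_head.
have mx : min_leaf x = 1.
  apply: min_leafE => // k; rewrite (perm_mem px) in_cons.
  by move=> /predU1P[->//|/labels_gt1/ltnW].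
split; last first.
  apply/setP => i; rewrite inE (perm_mem px) in_cons /=.
  by rewrite mem_labels.
split=> //=; last first.
  by rewrite (perm_trans _ (labelsC S)) // perm_cat.
by apply/allP => k; rewrite (perm_mem py) mx => /labels_gt1.
Qed.

Lemma finite_pointed_pairs A B n : locally_finite A -> locally_finite B ->
  (forall t, A t -> leaves t != [::]) -> finite_set (pointed_pairs A B n).
Proof.
move=> finA finB A0.
have := @bigcup_finite _ _ [set: {set 'I_n}]
  (fun S => on_labels A (1 :: labels S) `*` on_labels B (labels (~: S))).
have finS : finite_set [set: {set 'I_n}] by apply: finite_finset.
move=> /(_ finS) H; apply: sub_finite_set (H _) => [p pp|S _].
  by exists (fiber n p) => //; rewrite -pointed_pairs_fiber.
exact: finite_setX.
Qed.

(** Fibers over label sets of the same size have the same cardinality, so they are grouped by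
    size. *)
Lemma ncard_pointed_pairs A B n :
  equivariant A -> equivariant B -> locally_finite A -> locally_finite B ->
  (forall t, A t -> leaves t != [::]) ->
  ncard (pointed_pairs A B n)
    = \sum_(k < n.+1) 'C(n, k) *
        (ncard (on_labels A (iota 1 k.+1)) * ncard (on_labels B (iota 1 (n - k)))).
Proof.
move=> eqA eqB finA finB A0.
rewrite (ncard_fibers (@fiber n) (finite_pointed_pairs n finA finB A0)).
have lt_S (S : {set 'I_n}) : #|S| < n.+1.
  by rewrite ltnS -[leqRHS]card_ord max_card.
rewrite (partition_big (fun S : {set 'I_n} => Ordinal (lt_S S)) predT) //=.
apply: eq_bigr => k _.
transitivity (\sum_(S : {set 'I_n} | #|S| == k)
  ncard (on_labels A (iota 1 k.+1)) * ncard (on_labels B (iota 1 (n - k)))).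
  apply: eq_bigr => S /eqP cS; rewrite pointed_pairs_fiber // ncardX //.
  have uS : uniq (1 :: labels S).
    by rewrite /= uniq_labels andbT; apply/negP => /labels_gt1.
  rewrite (ncard_on_labels eqA finA uS).
  rewrite (ncard_on_labels eqB finB (uniq_labels _)) /= !size_map -!cardE.
  have cSk : #|S| = k by rewrite -cS.
  have cCk : #|(~: S)%SET| = n - k by rewrite cardsCs finset.setCK cSk card_ord.
  by rewrite cSk cCk.
rewrite sum_nat_const; congr (_ * _).
by have := card_draws 'I_n k; rewrite card_ord cardsE.
Qed.

(* The derivative counts the pairs (x, y) whose smallest label lies in x. *)
Lemma tree_egf_derivM A B C (phi : tree * tree -> tree) (psi : tree -> tree * tree) :
  equivariant A -> equivariant B -> locally_finite A -> locally_finite B ->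
  (forall t, A t -> leaves t != [::]) ->
  (forall x y, A x -> B y -> all (ltn (min_leaf x)) (leaves y) ->
     [/\ C (phi (x, y)), perm_eq (leaves (phi (x, y))) (leaves x ++ leaves y)
       & psi (phi (x, y)) = (x, y)]) ->
  (forall t, C t -> leaves t != [::] ->
     [/\ A (psi t).1, B (psi t).2,
         all (ltn (min_leaf (psi t).1)) (leaves (psi t).2) & phi (psi t) = t]) ->
  fps_deriv (tree_egf C) = (fps_deriv (tree_egf A) * tree_egf B)%R.
Proof.
move=> eqA eqB finA finB A0 phiP psiP; apply: fpsP => n.
(* [phi] and [psi] are inverse bijections between the pointed pairs and the trees of [C] on [n.+1]
   labels. *)
have cC : ncard (on_labels C (iota 1 n.+1)) = ncard (pointed_pairs A B n).
  apply: (ncard_bij (f := phi) (g := psi)); first exact: finite_pointed_pairs.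
  - move=> [x y] [/= Ax By lt_xy pxy]; have [Cp pp _] := phiP x y Ax By lt_xy.
    by split=> //; apply: perm_trans pxy.
  - move=> t [Ct pt]; have [|Ax By lt_xy phit] := psiP t Ct.
      by apply/eqP => t0; have := perm_size pt; rewrite t0 size_iota.
    split=> //; move: phit (phiP _ _ Ax By lt_xy); rewrite -surjective_pairing.
    by move=> -> [_ + _]; rewrite perm_sym => /perm_trans; apply.
  - by move=> [x y] [/= Ax By lt_xy pxy]; have [] := phiP x y Ax By lt_xy.
  - move=> t [Ct pt]; have [|//] := psiP t Ct.
    by apply/eqP => t0; have := perm_size pt; rewrite t0 size_iota.
rewrite coeffM fps_deriv_tree_egfE cC ncard_pointed_pairs // natr_sum mulr_suml.
apply: eq_bigr => k _; rewrite fps_deriv_tree_egfE tree_egfE.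
have le_k : k <= n by rewrite -ltnS.
(* The binomial coefficient turns [1 / n!] into the product of [1 / k!] and [1 / (n - k)!], the
   normalizations of the two factors. *)
rewrite -(bin_fact le_k) !natrM !invfM.
have nz m : (m`!%:R != 0 :> rat)%R by rewrite Num.Theory.pnatr_eq0 -lt0n fact_gt0.
have bnz : ('C(n, k)%:R != 0 :> rat)%R.
  by rewrite Num.Theory.pnatr_eq0 -lt0n bin_gt0.
set a := (ncard _)%:R%R; set b := (ncard _)%:R%R; set c := 'C(n, k)%:R%R.
rewrite -/c in bnz *.
rewrite mulrACA mulfV // mul1r.
by rewrite mulrACA.
Qed.

End LabelledClasses.

Lemma leq_sumn s x : x \in s -> x <= sumn s.
Proof.
elim: s => //= y s IH; rewrite in_cons => /predU1P[->|/IH]; first exact: leq_addr.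
by move/leq_trans; apply; apply: leq_addl.
Qed.

(** * Forests and grafting *)

Lemma root_oplus_map f t : root_oplus (map_leaves f t) = root_oplus t.
Proof. by case: t. Qed.

Lemma root_ominus_map f t : root_ominus (map_leaves f t) = root_ominus t.
Proof. by case: t. Qed.

(** Comparing with every leaf is equivalent to comparing with the minimal ones, and puts the order
    condition in the form used by pointed pairs. *)
Lemma sorted_min_leaf t ts :
  {in ts, forall u, leaves u != [::]} ->
  sorted ltn (map min_leaf (t :: ts)) =
  sorted ltn (map min_leaf ts) && all (ltn (min_leaf t)) (flatten (map leaves ts)).
Proof.
move=> ts0; apply/idP/andP => [/= pts|[sts /allP lt_t]].
  split; first exact: path_sorted pts.
  apply/allP => x /flatten_mapP[u uts xu].
  have /allP /(_ (min_leaf u)) := order_path_min ltn_trans pts.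
  by move=> /(_ (map_f _ uts)) /= /leq_trans; apply; apply: min_leaf_le.
rewrite /= path_min_sorted //; apply/allP => _ /mapP[u uts ->].
by apply: lt_t; apply/flatten_mapP; exists u => //; apply/min_leaf_in/ts0.
Qed.

Lemma min_leaf_cons d t ts : leaves t != [::] ->
  all (ltn (min_leaf t)) (flatten (map leaves ts)) ->
  min_leaf (Node d (t :: ts)) = min_leaf t.
Proof.
move=> t0 /allP lt_t; apply: min_leafE => [|x].
  by rewrite /= mem_cat min_leaf_in.
by rewrite /= mem_cat => /orP[/min_leaf_le //|/lt_t /ltnW].
Qed.

Section Canonical.
Local Open Scope classical_set_scope.
Variable P : set lgraph.
Hypothesis P_prime : forall H : lgraph, P H -> prime_graph (tagged H).

(** The condition on the children of an oplus node without the bound on their number, so that empty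
    and one-tree forests are allowed. *)
Definition forest (ts : seq tree) : bool :=
  [&& sorted ltn (map min_leaf ts), all (canonical P) ts & ~~ has root_oplus ts].

(** Primality bounds the arity of prime nodes from below; all internal nodes then branch, which
    makes the counted sets finite. *)
Lemma P_size H : P H -> 2 < lgraph_size H.
Proof. by case/P_prime; rewrite card_ord. Qed.

Lemma canonical_arity d ts : canonical P (Node d ts) -> 1 < size ts.
Proof.
case: d => [||H] /= /and3P[]; try by case/andP.
by move=> /andP[+ /eqP ->]; rewrite in_setE => /P_size /ltnW.
Qed.

Lemma canonical_sorted d ts :
  canonical P (Node d ts) -> sorted ltn (map min_leaf ts).
Proof. by case/and3P. Qed.

Lemma canonical_child d ts t : canonical P (Node d ts) -> t \in ts -> canonical P t.
Proof. by case/and3P => _ _ /allP; apply. Qed.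

Lemma canonical_Oplus ts : canonical P (Node Oplus ts) = (1 < size ts) && forest ts.
Proof. by rewrite /forest /= -andbA [all _ _ && _]andbC [X in _ && X]andbCA. Qed.

Lemma canonical_leaves t : canonical P t -> leaves t != [::].
Proof.
elim/tree_ind_seq: t => // d [|t ts] IH ct; first by have := canonical_arity ct.
have := IH t (mem_head _ _) (canonical_child ct (mem_head _ _)).
by rewrite /=; case: (leaves t).
Qed.

Lemma canonical_cons d t ts : canonical P (Node d (t :: ts)) ->
  all (ltn (min_leaf t)) (flatten (map leaves ts)).
Proof.
move=> ct; have := canonical_sorted ct; rewrite sorted_min_leaf; first by case/andP.
move=> u uts; apply/canonical_leaves/(canonical_child ct).
by rewrite in_cons uts orbT.
Qed.

Lemma canonical_min_leaf d t ts : canonical P (Node d (t :: ts)) ->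
  min_leaf (Node d (t :: ts)) = min_leaf t.
Proof.
move=> ct; apply: min_leaf_cons (canonical_cons ct).
exact/canonical_leaves/(canonical_child ct)/mem_head.
Qed.

Lemma sorted_map_leaves f ts :
  {in ts, forall t, leaves t != [::]} ->
  {in flatten (map leaves ts) &, {homo f : x y / x < y}} ->
  sorted ltn (map min_leaf ts) ->
  sorted ltn (map min_leaf (map (map_leaves f) ts)).
Proof.
move=> ts0 hf; rewrite -map_comp.
have -> : map (min_leaf \o map_leaves f) ts = map (f \o min_leaf) ts.
  apply/eq_in_map => t tts; apply: min_leaf_map; first exact: ts0.
  by move=> x y xt yt; apply: hf; apply/flatten_mapP; exists t.
rewrite map_comp; apply: (homo_sorted_in hf).
by apply/allP => _ /mapP[t tts ->]; apply/flatten_mapP; exists t => //; apply/min_leaf_in/ts0.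
Qed.

Lemma canonical_map f t : {in leaves t &, {homo f : x y / x < y}} ->
  canonical P t -> canonical P (map_leaves f t).
Proof.
elim/tree_ind_seq: t => // d ts IH hf ct.
have st : sorted ltn (map min_leaf (map (map_leaves f) ts)).
  apply: sorted_map_leaves (canonical_sorted ct) => // t tts.
  exact/canonical_leaves/(canonical_child ct).
have at_ : all (canonical P) (map (map_leaves f) ts).
  rewrite all_map; apply/allP => t tts /=.
  apply: IH (canonical_child ct tts) => // x y xt yt.
  by apply: hf; apply: mem_leaves_Node xt || apply: mem_leaves_Node yt.
case/and3P: ct => dts _ _.
rewrite /= st at_ !andbT; case: d dts {hf} => [||H]; rewrite size_map // has_map.
  by rewrite (eq_has (root_oplus_map f)).
by rewrite (eq_has (root_ominus_map f)).
Qed.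

Lemma forest_map f ts : {in flatten (map leaves ts) &, {homo f : x y / x < y}} ->
  forest ts -> forest (map (map_leaves f) ts).
Proof.
move=> hf /and3P[st /allP ct ot]; apply/and3P; split.
- by apply: sorted_map_leaves => // t /ct/canonical_leaves.
- rewrite all_map; apply/allP => t tts; apply: canonical_map (ct t tts).
  by move=> x y xt yt; apply: hf; apply/flatten_mapP; exists t.
- by rewrite has_map (eq_has (root_oplus_map f)).
Qed.

(** * Finiteness of the classes of trees *)

Lemma finite_lgraphs n : finite_set [set H : lgraph | lgraph_size H <= n].
Proof.
have := @bigcup_finite _ _ `I_n
  (fun k => existT (fun k => sgraph 'I_k.+1) k @` [set: sgraph 'I_k.+1]).
move=> /(_ (finite_II n)) fin; apply: sub_finite_set (fin _).
  by move=> [k G] /= lt_k; exists k => //; exists G.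
by move=> k _; apply: finite_image; apply: finite_finset.
Qed.

Lemma finite_decorations n :
  finite_set [set d : decoration lgraph |
                if d is Prime H then lgraph_size H <= n else true].
Proof.
apply: (@sub_finite_set _ _
  ([set Oplus; Ominus] `|` (@Prime _) @` [set H : lgraph | lgraph_size H <= n])).
  by move=> [||H] /= Hn; [left; left | left; right | right; exists H].
rewrite finite_setU; split; first exact: finite_set2.
exact/finite_image/finite_lgraphs.
Qed.

Lemma leq_size_leaves ts : {in ts, forall t, leaves t != [::]} ->
  size ts <= size (flatten (map leaves ts)).
Proof.
elim: ts => //= t ts IH ts0; rewrite size_cat -add1n leq_add //.
  by have := ts0 t (mem_head _ _); case: (leaves t).
by apply: IH => u uts; apply: ts0; rewrite in_cons uts orbT.
Qed.

Lemma leq_size_child t ts : t \in ts ->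
  size (leaves t) <= size (flatten (map leaves ts)).
Proof.
elim: ts => // u ts IH; rewrite in_cons size_cat => /predU1P[->|/IH].
  exact: leq_addr.
by move/leq_trans; apply; apply: leq_addl.
Qed.

(** A node has another child, and that child has a leaf. This strict decrease drives the induction
    in [finite_canonical_bounded]. *)
Lemma canonical_child_size d ts t : canonical P (Node d ts) -> t \in ts ->
  size (leaves t) < size (leaves (Node d ts)).
Proof.
move=> ct /[dup] tts /rot_to[i s rts].
have pts : perm_eq (t :: s) ts by rewrite -rts perm_rot.
have ss : 0 < size s by have := canonical_arity ct; rewrite -(perm_size pts).
have -> : size (leaves (Node d ts)) = size (flatten (map leaves (t :: s))).
  by apply/perm_size/perm_flatten/perm_map; rewrite perm_sym.
case: s ss pts {rts} => // u s _ pts; rewrite /= !size_cat.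
have : leaves u != [::].
  apply/canonical_leaves/(canonical_child ct).
  by rewrite -(perm_mem pts) !in_cons eqxx orbT.
by case: (leaves u) => //= x r _; rewrite addSn addnS ltnS leq_addr.
Qed.

(** Induction on the number of leaves: a node is given by a decoration of bounded size and a bounded
    list of trees with fewer leaves. *)
Lemma finite_canonical_bounded N n : finite_set
  [set t | [/\ canonical P t, all (gtn N) (leaves t) & size (leaves t) <= n]].
Proof.
elim: n => [|n IHn].
  apply: sub_finite_set (finite_set0 _) => t [/canonical_leaves].
  by case: (leaves t).
set S := [set t | _] in IHn.
apply: (@sub_finite_set _ _ ((Leaf @` `I_N) `|`
  (fun p => Node p.1 p.2) @`
    ([set d : decoration lgraph | if d is Prime H then lgraph_size H <= n.+1 else true]
     `*` [set s | {in s, forall x, S x} /\ (size s <= n.+1)%N]))).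
  move=> [l [_ /andP[lN _] _]|d ts [ct /allP aN sz]]; [by left; exists l | right].
  have szts : size ts <= n.+1.
    apply: leq_trans sz; apply: leq_size_leaves => t tts.
    exact/canonical_leaves/(canonical_child ct).
  exists (d, ts) => //; split=> /=; last first.
    split=> // t tts; split; first exact: canonical_child ct tts.
      by apply/allP => x xt; apply/aN/mem_leaves_Node/xt.
    by rewrite -ltnS (leq_trans (canonical_child_size ct tts)).
  by case: d ct {aN sz} => // H /and3P[/andP[_ /eqP <-]].
rewrite finite_setU; split; first exact/finite_image/finite_II.
apply/finite_image/finite_setX; first exact: finite_decorations.
exact: finite_seqs.
Qed.

Lemma locally_finite_canonical : locally_finite [set t | canonical P t].
Proof.
(* [sumn s] is a crude bound on the labels. *)
move=> s; apply: sub_finite_set (finite_canonical_bounded (sumn s).+1 (size s)).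
move=> t [ct pt]; split=> //; last by rewrite (perm_size pt).
by apply/allP => x; rewrite (perm_mem pt) /= ltnS => /leq_sumn.
Qed.

(* A forest is encoded as the (possibly non canonical) oplus node above its
   trees, so that both factors of a labelled product are classes of trees. *)
Definition forests : set tree :=
  [set t | exists2 ts, t = Node Oplus ts & forest ts].

Lemma equivariant_forests : equivariant forests.
Proof.
move=> f t hf [ts tE fts]; exists (map (map_leaves f) ts); first by rewrite tE.
by apply: forest_map => //; rewrite tE in hf.
Qed.

Lemma locally_finite_forests : locally_finite forests.
Proof.
move=> s; set S := [set t | [/\ canonical P t, all (gtn (sumn s).+1) (leaves t)
  & size (leaves t) <= size s]].
apply: (@sub_finite_set _ _
  (Node Oplus @` [set ts | {in ts, forall t, S t} /\ size ts <= size s])).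
  move=> _ [[ts -> /and3P[_ /allP ct _]] pt]; exists ts => //.
  split; last first.
    rewrite -(perm_size pt); apply: leq_size_leaves => t /ct; exact: canonical_leaves.
  move=> t tts; split; first exact: ct.
    apply/allP => x xt; have := mem_leaves_Node Oplus tts xt.
    by rewrite (perm_mem pt) /= ltnS => /leq_sumn.
  by rewrite -(perm_size pt); apply: leq_size_child.
apply/finite_image/finite_seqs; exact: finite_canonical_bounded.
Qed.

Definition notoplus : set tree := [set t | canonical P t /\ ~~ root_oplus t].

Lemma sub_locally_finite (A : set tree) :
  (forall t, A t -> canonical P t) -> locally_finite A.
Proof.
move=> cA s; apply: sub_finite_set (locally_finite_canonical s) => t [/cA].
by split.
Qed.

(** * Decomposition of forests and of oplus roots *)

Lemma forest_cons t ts :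
  forest (t :: ts) = [&& canonical P t, ~~ root_oplus t, forest ts
                       & all (ltn (min_leaf t)) (flatten (map leaves ts))].
Proof.
have ts0 : all (canonical P) ts -> {in ts, forall u, leaves u != [::]}.
  by move=> /allP ct u /ct/canonical_leaves.
rewrite /forest; apply/and3P/and4P.
  move=> [+ /= /andP[ct cts]]; rewrite sorted_min_leaf; last exact: ts0.
  by move=> /andP[-> ->]; rewrite negb_or cts => /andP[-> ->].
move=> [ct ot /and3P[sts cts ots] lt_t]; rewrite sorted_min_leaf; last exact: ts0.
by rewrite sts lt_t /= ct cts negb_or ot ots.
Qed.

Definition children (t : tree) : seq tree := if t is Node _ ts then ts else [::].

(** The tree with the smallest label comes first in a sorted forest, so [phi] is consing. The
    default [Leaf 0] occurs only for the empty forest, which has no leaf. *)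
Lemma forests_deriv :
  fps_deriv (tree_egf forests)
  = (fps_deriv (tree_egf notoplus) * tree_egf forests)%R.
Proof.
apply: (tree_egf_derivM
  (phi := fun p => Node Oplus (p.1 :: children p.2))
  (psi := fun t => (head (Leaf 0) (children t), Node Oplus (behead (children t))))).
- by move=> f t hf [ct ot]; split; [apply: canonical_map | rewrite root_oplus_map].
- exact: equivariant_forests.
- by apply: sub_locally_finite => t [].
- exact: locally_finite_forests.
- by move=> t [/canonical_leaves].
- move=> x y [cx ox] [ts -> fts] lt_x; split=> //=.
  by exists (x :: ts) => //; rewrite forest_cons cx ox fts.
- move=> _ [[|u us] -> +] => [_ //|]; rewrite forest_cons => /and4P[cu ou fus lt_u] _ /=.
  by split=> //; exists us.
Qed.

Lemma canonical_Oplus_cons t ts : canonical P (Node Oplus (t :: ts)) ->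
  [/\ canonical P t, ~~ root_oplus t, ts != [::], forest ts
    & all (ltn (min_leaf t)) (flatten (map leaves ts))].
Proof.
rewrite canonical_Oplus forest_cons => /andP[sz /and4P[-> -> -> ->]].
by split=> //; case: ts sz.
Qed.

(** The empty forest is treated apart because an oplus node with a single child is not canonical. *)
Definition join_root (p : tree * tree) : tree :=
  if children p.2 is [::] then p.1 else Node Oplus (p.1 :: children p.2).

Definition split_root (t : tree) : tree * tree :=
  if t is Node Oplus (x :: ts) then (x, Node Oplus ts) else (t, Node Oplus [::]).

Lemma split_root_notoplus t : ~~ root_oplus t -> split_root t = (t, Node Oplus [::]).
Proof. by case: t => // -[]. Qed.

(** A tree with an oplus root is split into its first child and the forest of the others; any other
    tree is paired with the empty forest. The second condition on [Q] says that it is insensitive to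
    this splitting. *)
Lemma root_decomposition (Q : pred tree) :
  (forall f t, Q (map_leaves f t) = Q t) ->
  (forall x ts, Q (Node Oplus (x :: ts)) = Q x) ->
  fps_deriv (tree_egf [set t | canonical P t /\ Q t])
  = (fps_deriv (tree_egf [set t | [/\ canonical P t, ~~ root_oplus t & Q t]])
     * tree_egf forests)%R.
Proof.
move=> Qmap Qroot; apply: (tree_egf_derivM (phi := join_root) (psi := split_root)).
- move=> f t hf [ct ot Qt]; split; [exact: canonical_map| |by rewrite Qmap].
  by rewrite root_oplus_map.
- exact: equivariant_forests.
- by apply: sub_locally_finite => t [].
- exact: locally_finite_forests.
- by move=> t [/canonical_leaves].
- move=> x y [cx ox Qx] [[|t ts] -> fts] lt_x.
    by rewrite /join_root /= cats0 split_root_notoplus.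
  split=> //; split; last by rewrite Qroot.
  by rewrite canonical_Oplus forest_cons cx ox fts.
- move=> t [ct Qt] _; case: (boolP (root_oplus t)) => ot; last first.
    by rewrite split_root_notoplus //; split=> //; exists [::].
  case: t ot ct Qt => // -[] // [//|x ts] _.
  rewrite Qroot => /canonical_Oplus_cons[cx ox ts0 fts lt_x] Qx; split=> //=.
    by exists ts.
  by rewrite /join_root /=; case: (ts) ts0.
Qed.

(* In a canonical tree the leftmost leaf carries the smallest label; [lparent p]
   tests its parent. *)
Fixpoint lparent (p : pred (decoration lgraph)) (t : tree) : bool :=
  match t with
  | Node d (Leaf _ :: _) => p d
  | Node _ (t' :: _) => lparent p t'
  | _ => false
  end.

(** * Grafting a forest next to the leftmost leaf *)

Definition is_leaf (t : tree) : bool := if t is Leaf _ then true else false.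

Lemma lparent_cons p d t ts :
  lparent p (Node d (t :: ts)) = if is_leaf t then p d else lparent p t.
Proof. by case: t. Qed.

Lemma lparent_map p f t : lparent p (map_leaves f t) = lparent p t.
Proof.
elim/tree_ind_seq: t => // d [|t ts] // IH.
have IHt := IH t (mem_head _ _).
rewrite [map_leaves _ _]/= !lparent_cons IHt.
by case: t {IH IHt}.
Qed.

(** The leftmost leaf receives an oplus parent whose other children are [ts], unless [ts] is empty,
    since a lone child would not be canonical. *)
Fixpoint graft (ts : seq tree) (t : tree) : tree :=
  match t with
  | Node d (t' :: us) => Node d (graft ts t' :: us)
  | Node _ [::] => t
  | Leaf _ => if ts is [::] then t else Node Oplus (t :: ts)
  end.

(** Together with [pruned], the inverse of [graft]: an oplus parent of the leftmost leaf is
    contracted to that leaf. *)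
Fixpoint prune (t : tree) : tree :=
  match t with
  | Node d (t' :: us) =>
      if is_oplus d && is_leaf t' then t' else Node d (prune t' :: us)
  | _ => t
  end.

Fixpoint pruned (t : tree) : seq tree :=
  match t with
  | Node d (t' :: us) => if is_oplus d && is_leaf t' then us else pruned t'
  | _ => [::]
  end.

(** An unchanged minimal leaf keeps the siblings sorted; what remains is to exclude equal signs on
    parent and child. *)
Lemma canonical_replace_child d t t' ts :
  min_leaf t' = min_leaf t -> canonical P t' ->
  (is_oplus d -> ~~ root_oplus t') -> (is_ominus d -> ~~ root_ominus t') ->
  canonical P (Node d (t :: ts)) -> canonical P (Node d (t' :: ts)).
Proof.
move=> mt ct' ot' omt' /and3P[dts sts /= /andP[_ cts]].
apply/and3P; split; [|by move: sts; rewrite /= mt | by rewrite /= ct'].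
case: d dts ot' omt' => //= /andP[sz]; rewrite !negb_or => /andP[_ hts].
  by move=> -> //; rewrite sz.
by move=> _ -> //; rewrite sz.
Qed.

(** The new oplus node has no oplus parent by the hypothesis on [lparent], and minimal leaves along
    the leftmost branch do not change. *)
Lemma graftP ts t : forest ts -> canonical P t -> ~~ lparent (@is_oplus _) t ->
  all (ltn (min_leaf t)) (flatten (map leaves ts)) ->
  [/\ canonical P (graft ts t), min_leaf (graft ts t) = min_leaf t,
      perm_eq (leaves (graft ts t)) (leaves t ++ flatten (map leaves ts)),
      prune (graft ts t) = t & pruned (graft ts t) = ts].
Proof.
move=> fts; elim/tree_ind_seq: t => [l|d [|u us] IH] ct lt lt_ts.
- case: ts fts lt_ts => // v vs fts lt_l; split=> //.
    by rewrite canonical_Oplus forest_cons fts.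
  by apply: min_leaf_cons.
- by have := canonical_arity ct.
have cu : canonical P u by apply: canonical_child ct (mem_head _ _).
have mu := canonical_min_leaf ct.
rewrite lparent_cons in lt; rewrite mu in lt_ts.
have [|cg mg pg prg prdg] := IH u (mem_head _ _) cu _ lt_ts.
  by case: (u) lt.
have cG : canonical P (graft ts (Node d (u :: us))).
  apply: canonical_replace_child (ct) => //=.
    case: d {IH mu} ct lt => // /canonical_Oplus_cons[_ + _ _ _].
    by case: (u) => // -[||H] [] //=.
  case: d {IH mu lt} ct => // /and3P[/andP[_ /= ou] _ _] _.
  move: ou; rewrite negb_or => /andP[+ _].
  by case: (u) => [l|d []] //; case: (ts).
(* If [d] is oplus then [u] is not a leaf, hence neither is its graft, and [prune] continues down
   the branch. *)
have prune_cond : is_oplus d && is_leaf (graft ts u) = false.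
  by case: (u) lt => [l|d' []] /=; case: (d).
split=> //.
- by rewrite mu -mg [graft _ _]/= (canonical_min_leaf cG).
- by rewrite /= perm_sym perm_catAC perm_cat2r perm_sym.
- by rewrite /= prune_cond prg.
- by rewrite /= prune_cond prdg.
Qed.

(** In a canonical tree no oplus node has an oplus child, so contracting one leaves the leftmost
    leaf without an oplus parent. *)
Lemma pruneP t : canonical P t ->
  [/\ canonical P (prune t), ~~ lparent (@is_oplus _) (prune t),
      forest (pruned t), min_leaf (prune t) = min_leaf t &
      all (ltn (min_leaf t)) (flatten (map leaves (pruned t)))
      /\ graft (pruned t) (prune t) = t].
Proof.
elim/tree_ind_seq: t => [l|d [|u us] IH] ct; [by [] | by have := canonical_arity ct |].
have cu : canonical P u by apply: canonical_child ct (mem_head _ _).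
have mu := canonical_min_leaf ct.
have [cp lp fp mp [lt_p gp]] := IH u (mem_head _ _) cu.
rewrite /=; case: ifP => [/andP[]|dl].
  case: d {IH mu} ct => // ct _; case: u {cu cp lp fp mp lt_p gp} ct => // l ct _.
  have [_ _ us0 fus lt_l] := canonical_Oplus_cons ct.
  split=> //; rewrite ?(canonical_min_leaf ct) //; split=> //.
  by case: (us) us0.
(* When [d] is oplus, [u] is an internal node that is not oplus, and [prune] keeps its root. *)
have pleaf : is_oplus d -> ~~ root_oplus (prune u) && ~~ is_leaf (prune u).
  case: d {IH mu} dl ct => //= ul /canonical_Oplus_cons[_ + _ _ _] _.
  by case: (u) ul => // -[||H] [|? ?] //=.
have cP : canonical P (Node d (prune u :: us)).
  apply: canonical_replace_child (ct) => //; first by move=> /pleaf/andP[].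
  (* Below an ominus node, pruning [u] either keeps its root or yields a leaf. *)
  case: d {IH mu dl pleaf} ct => // /and3P[/andP[_ /= ou] _ _] _.
  move: ou; rewrite negb_or => /andP[+ _].
  case: (u) => // d [//|u' us'] /=; case: ifP => //.
  by case: (u') => // d' ?; rewrite andbF.
split=> //.
- rewrite lparent_cons; case: ifP => // pl.
  by apply/negP => /pleaf; rewrite pl andbF.
- by rewrite mu (canonical_min_leaf cP).
- by rewrite mu; split=> //=; rewrite gp.
Qed.

Lemma graft_decomposition :
  fps_deriv (tree_egf [set t | canonical P t])
  = (fps_deriv (tree_egf [set t | canonical P t /\ ~~ lparent (@is_oplus _) t])
     * tree_egf forests)%R.
Proof.
apply: (tree_egf_derivM (phi := fun p => graft (children p.2) p.1)
  (psi := fun t => (prune t, Node Oplus (pruned t)))).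
- by move=> f t hf [ct lt]; split; [apply: canonical_map | rewrite lparent_map].
- exact: equivariant_forests.
- by apply: sub_locally_finite => t [].
- exact: locally_finite_forests.
- by move=> t [/canonical_leaves].
- by move=> x y [cx lx] [ts -> fts] lt_x; have [? ? ? /= -> ->] := graftP fts cx lx lt_x.
- move=> t /pruneP[cp lp fp mp [lt_p gp]] _; split=> //=; last by rewrite mp.
  by exists (pruned t).
Qed.

(** * Exchange of oplus and ominus *)

Definition swap_decoration G (d : decoration G) : decoration G :=
  match d with Oplus => Ominus | Ominus => Oplus | _ => d end.

(** Prime decorations are kept, since [P] is not assumed closed under complementation. *)
Fixpoint swap (t : tree) : tree :=
  if t is Node d ts then Node (swap_decoration d) (map swap ts) else t.

Lemma swapK : involutive swap.
Proof.
elim/tree_ind_seq => // d ts IH /=; congr Node; first by case: d.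
by rewrite -map_comp -[RHS]map_id; apply/eq_in_map => t /IH.
Qed.

Lemma leaves_swap t : leaves (swap t) = leaves t.
Proof.
elim/tree_ind_seq: t => //= d ts IH; rewrite -map_comp.
by congr flatten; apply/eq_in_map => t /IH.
Qed.

Lemma canonical_swap t : canonical P t -> canonical P (swap t).
Proof.
elim/tree_ind_seq: t => //= d ts IH /and3P[dts sts cts].
rewrite size_map !has_map all_map -map_comp; apply/and3P; split.
- case: d dts => //= /andP[-> h] /=; move: h; congr (~~ _); apply: eq_has => -[] // [] //.
- move: sts; congr sorted; apply/eq_map => t /=; by rewrite /min_leaf leaves_swap.
- by apply/allP => t tts; apply: IH => //; apply: (allP cts).
Qed.

Lemma lparent_swap t : lparent (@is_oplus _) (swap t) = lparent (@is_ominus _) t.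
Proof.
elim/tree_ind_seq: t => // d [|t ts] // IH.
have IHt := IH t (mem_head _ _).
rewrite [swap _]/= !lparent_cons IHt.
by case: t {IH IHt} => //; case: d.
Qed.

Lemma tree_egf_swap :
  tree_egf [set t | canonical P t /\ ~~ lparent (@is_ominus _) t]
  = tree_egf [set t | canonical P t /\ ~~ lparent (@is_oplus _) t].
Proof.
apply: fpsP => n; rewrite !tree_egfE; congr (_%:R / _)%R.
apply: (ncard_bij (f := swap) (g := swap)); try by move=> t _; rewrite swapK.
- by apply: sub_locally_finite => t [].
- move=> t [[ct lt] pt]; split; rewrite ?leaves_swap //; split.
    exact: canonical_swap.
  by rewrite -lparent_swap swapK.
- move=> t [[ct lt] pt]; split; rewrite ?leaves_swap //; split.
    exact: canonical_swap.
  by rewrite lparent_swap.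
Qed.

End Canonical.

(** * Blossomed trees *)

Lemma pullback_comp (U V W : finType) (f : W -> V) (g : V -> U) (G : sgraph U) :
  pullback f (pullback g G) = pullback (g \o f) G.
Proof. by apply/val_inj/ffunP => -[x y]; rewrite !ffunE /adj /= ffunE. Qed.

Lemma eq_pullback (V W : finType) (f g : W -> V) (G : sgraph V) :
  f =1 g -> pullback f G = pullback g G.
Proof. by move=> fg; apply/val_inj/ffunP => -[x y]; rewrite !ffunE /= !fg. Qed.

Lemma pullback_id (V : finType) (f : V -> V) (G : sgraph V) :
  f =1 id -> pullback f G = G.
Proof. by move=> fid; apply/val_inj/ffunP => -[x y]; rewrite ffunE /= !fid. Qed.

Lemma unstar0K k : cancel (unstar (ord0 : 'I_k.+1)) (unlift ord0).
Proof. by case=> [j|] /=; rewrite ?liftK ?unlift_none. Qed.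

Lemma unlift0K k : cancel (unlift (ord0 : 'I_k.+1)) (unstar ord0).
Proof. by move=> j; case: unliftP. Qed.

Lemma unstar_inj k (i : 'I_k.+1) : injective (unstar i).
Proof.
move=> [x|] [y|] //=; first by move/lift_inj ->.
- by move=> xi; have := neq_lift i x; rewrite xi eqxx.
- by move=> xi; have := neq_lift i y; rewrite -xi eqxx.
Qed.

(** The starred vertex becomes vertex 0, because the blossom is to carry the smallest label and its
    branch is then the first child. *)
Definition unstar_decoration (d : decoration star_graph) : decoration lgraph :=
  match d with
  | Oplus => Oplus
  | Ominus => Ominus
  | Prime H => Prime (existT (fun k => sgraph 'I_k.+1) (tag H)
                             (pullback (unlift ord0) (tagged H)))
  end.

Lemma inord00 k : inord 0 = ord0 :> 'I_k.+1.
Proof. by apply: val_inj; rewrite /= inordK. Qed.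

Lemma star_decorationK :
  cancel (fun d => star_decoration d 0) unstar_decoration.
Proof.
case=> // -[k G]; rewrite /= inord00 pullback_comp pullback_id //.
exact: unlift0K.
Qed.

Lemma unstar_decorationK :
  cancel unstar_decoration (fun d => star_decoration d 0).
Proof.
case=> // -[k G]; rewrite /= /star /= inord00 pullback_comp pullback_id //.
exact: unstar0K.
Qed.

(* Since 1 is the smallest label, the blossom becomes the leftmost leaf. *)
Fixpoint unblossom (b : btree) : tree :=
  match b with
  | Blossom => Leaf 1
  | BNode d b' ts =>
      Node (unstar_decoration d) (unblossom b' :: map (map_leaves S) ts)
  end.

Lemma unblossom_inj : injective unblossom.
Proof.
have mapK : cancel (map_leaves S) (map_leaves predn).
  by move=> t; rewrite map_leaves_comp map_leaves_id.
elim=> [|d b IH ts] [|d' b' ts'] //= [] dd' /IH-> /(inj_map (can_inj mapK))->.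
by rewrite (can_inj unstar_decorationK dd').
Qed.

Lemma is_leaf_unblossom b : is_leaf (unblossom b) -> b = Blossom.
Proof. by case: b. Qed.

Lemma root_oplus_unblossom b : root_oplus (unblossom b) = broot_oplus b.
Proof. by case: b => // -[]. Qed.

Lemma lparent_unblossom p b : lparent p (unblossom b)
  = if blossom_parent b is Some d then p (unstar_decoration d) else false.
Proof.
elim: b => // d b IH ts; rewrite [unblossom _]/= lparent_cons IH.
by case: b {IH}.
Qed.

Lemma oplus_replaceableE b :
  oplus_replaceable b = ~~ lparent (@is_oplus _) (unblossom b).
Proof.
by rewrite /oplus_replaceable lparent_unblossom; case: blossom_parent => // -[].
Qed.

Lemma ominus_replaceableE b :
  ominus_replaceable b = ~~ lparent (@is_ominus _) (unblossom b).
Proof.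
by rewrite /ominus_replaceable lparent_unblossom; case: blossom_parent => // -[].
Qed.

Lemma tsize_unblossom b : Defs.tsize (unblossom b) = (bsize b).+1.
Proof.
rewrite /Defs.tsize; elim: b => // d b IH ts.
rewrite /= size_cat IH size_flatten /shape -!map_comp sumnE big_map.
by congr (_ + _).+1; apply: eq_bigr => t _; rewrite /= leaves_map size_map.
Qed.

(* The labels of [unblossom (blossoming l t)] in terms of those of t. *)
Definition move_to1 (l x : nat) : nat := if x == l then 1 else (unbump l x).+1.

Lemma move_to1_gt0 l x : 0 < move_to1 l x.
Proof. by rewrite /move_to1; case: ifP. Qed.

Lemma unbump_homo l x y : x != l -> y != l -> x < y -> unbump l x < unbump l y.
Proof. rewrite /unbump; lia. Qed.

(** The map is injective from a finite set to itself, hence a permutation. *)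
Lemma perm_move_to1 l n : 0 < l <= n ->
  perm_eq (map (move_to1 l) (iota 1 n)) (iota 1 n).
Proof.
move=> ln; have um : uniq (map (move_to1 l) (iota 1 n)).
  rewrite map_inj_in_uniq ?iota_uniq // => x y; rewrite !mem_iota /move_to1 /unbump.
  by do 2!case: eqP => ?; lia.
have sub : {subset map (move_to1 l) (iota 1 n) <= iota 1 n}.
  move=> _ /mapP[x + ->]; rewrite !mem_iota /move_to1 /unbump.
  by case: eqP => ?; lia.
have [|_ eq_mem] := uniq_min_size um sub; first by rewrite size_map.
exact: uniq_perm (iota_uniq 1 n) eq_mem.
Qed.

(** * Blossomed trees as trees with the blossom at label 1 *)

Section Blossoms.
Local Open Scope classical_set_scope.
Variable P : set lgraph.
Hypothesis P_prime : forall H : lgraph, P H -> prime_graph (tagged H).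
Hypothesis P_stable : relabeling_stable P.

(** Starring vertex [i] and reinserting the star as vertex 0 permutes the vertices of [H]; stability
    of [P] under relabeling enters here. *)
Lemma unstar_star_in (H H1 : lgraph) i : P H ->
  unstar_decoration (Prime (star H i)) = Prime H1 -> P H1.
Proof.
case: H => k G PG [<-] /=; rewrite pullback_comp.
set f := _ \o _; have f_inj : injective f.
  by apply: inj_comp; [apply: unstar_inj | apply: can_inj (@unlift0K k)].
have := P_stable (perm f_inj) PG; rewrite (eq_pullback (g := f)) //.
exact: permE.
Qed.

Lemma root_oplus_blossoming l t :
  root_oplus (unblossom (blossoming l t)) = root_oplus t.
Proof. by case: t => // -[]. Qed.

Lemma root_ominus_blossoming l t :
  root_ominus (unblossom (blossoming l t)) = root_ominus t.
Proof. by case: t => // -[]. Qed.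

(** At each level the branch of [l] moves to the front, where its label 1 makes it minimal, and the
    other children keep their order because [unbump l] is increasing away from [l]. *)
Lemma canonical_blossoming l t : canonical P t -> uniq (leaves t) ->
  all (leq 1) (leaves t) -> l \in leaves t ->
  canonical P (unblossom (blossoming l t)) /\
  perm_eq (leaves (unblossom (blossoming l t))) (map (move_to1 l) (leaves t)).
Proof.
elim/tree_ind_seq: t => [k|d ts IH] ct ut /allP pt lt.
  by move: lt; rewrite /= inE => /eqP ->; rewrite /move_to1 eqxx.
have hts : has (fun u => l \in leaves u) ts.
  by have /flatten_mapP[u uts lu] := lt; apply/hasP; exists u.
set i := find (fun u => l \in leaves u) ts.
have lt_i : i < size ts by rewrite -has_find.
set u := nth (Leaf 0) ts i.
set r := take i ts ++ drop i.+1 ts.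
have lu : l \in leaves u by apply: nth_find hts.
have uts : u \in ts by apply: mem_nth.
have ets : ts = take i ts ++ u :: drop i.+1 ts by rewrite -drop_nth // cat_take_drop.
have pts : perm_eq ts (u :: r).
  by rewrite {1}ets /r -cat1s perm_catCA.
have pleaves : perm_eq (leaves (Node d ts)) (leaves u ++ flatten (map leaves r)).
  exact: perm_flatten (perm_map leaves pts).
have -> : blossoming l (Node d ts) = BNode (star_decoration d i) (blossoming l u)
    (map (map_leaves (unbump l)) r).
  by rewrite /= -/i (nth_map (Leaf 0)).
have sub_r : subseq r ts by rewrite [X in subseq _ X]ets cat_subseq // subseq_cons.
(* [f] adds 1 to the labels below [l] and fixes those above, which leaves 1 free for the blossom. *)
clearbody r; set f := S \o unbump l.
have -> : unblossom (BNode (star_decoration d i) (blossoming l u)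
      (map (map_leaves (unbump l)) r))
    = Node (unstar_decoration (star_decoration d i))
        (unblossom (blossoming l u) :: map (map_leaves f) r).
  by rewrite /= -map_comp; congr (Node _ (_ :: _)); apply: eq_map => t;
    rewrite /= map_leaves_comp.
have uur : uniq (leaves u ++ flatten (map leaves r)) by rewrite -(perm_uniq pleaves).
have l_pos : 0 < l by apply: pt.
have lr x : x \in flatten (map leaves r) -> x != l /\ 0 < x.
  move=> xr; split; last by apply: pt; rewrite (perm_mem pleaves) mem_cat xr orbT.
  apply: contraTneq uur => xl; rewrite cat_uniq; apply/negP => /and3P[_ /hasPn + _].
  by move=> /(_ _ xr); rewrite xl lu.
have cr t : t \in r -> canonical P t.
  by move=> tr; apply: canonical_child ct _; rewrite (perm_mem pts) in_cons tr orbT.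
have f_homo : {in flatten (map leaves r) &, {homo f : x y / x < y}}.
  by move=> x y /lr[xl _] /lr[yl _] xy; rewrite ltnS unbump_homo.
have [||cu pu] := IH u uts (canonical_child ct uts) _ _ lu.
- by move: uur; rewrite cat_uniq => /andP[].
- by apply/allP => x xu; apply/pt/mem_leaves_Node/xu.
have mu : min_leaf (unblossom (blossoming l u)) = 1.
  apply: min_leafE => [|x]; rewrite (perm_mem pu).
    by apply/mapP; exists l; rewrite // /move_to1 eqxx.
  by move=> /mapP[y _ ->]; apply: move_to1_gt0.
split; last first.
  have := perm_map (move_to1 l) pleaves; rewrite perm_sym; apply: perm_trans.
  rewrite map_cat /=; apply: perm_cat => //; rewrite map_flatten -!map_comp.
  have -> // : map (leaves \o map_leaves f) r = map (map (move_to1 l) \o leaves) r.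
  apply/eq_in_map => t tr; rewrite /= leaves_map; apply/eq_in_map => x xt.
  have [xl _] : x != l /\ 0 < x by apply: lr; apply/flatten_mapP; exists t.
  by rewrite /move_to1 (negbTE xl).
have cmr : {in map (map_leaves f) r, forall t, canonical P t}.
  move=> _ /mapP[t tr ->]; apply: canonical_map (cr t tr) => //.
  by move=> x y xt yt; apply: f_homo; apply/flatten_mapP; exists t.
rewrite /=; apply/and3P; split.
- case/and3P: ct => dts _ _; case: d dts {pleaves lt IH pt ut}.
  + rewrite /= (perm_size pts) (perm_has _ pts) /= size_map has_map.
    by rewrite root_oplus_blossoming (eq_has (root_oplus_map f)).
  + rewrite /= (perm_size pts) (perm_has _ pts) /= size_map has_map.
    by rewrite root_ominus_blossoming (eq_has (root_ominus_map f)).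
  move=> H /andP[]; rewrite (perm_size pts) /= size_map !in_setE => PH ->.
  by rewrite andbT in_setE; apply: (@unstar_star_in H _ i PH).
- rewrite -[path _ _ _]/(sorted ltn (map min_leaf
      (unblossom (blossoming l u) :: map (map_leaves f) r))) sorted_min_leaf; last first.
    by move=> t /cmr; apply: canonical_leaves.
  rewrite mu; apply/andP; split.
    apply: sorted_map_leaves => // [t /cr|]; first exact: canonical_leaves.
    apply: subseq_sorted (canonical_sorted ct); first exact: ltn_trans.
    exact: map_subseq.
  apply/allP => x /flatten_mapP[_ /mapP[t tr ->]]; rewrite leaves_map.
  move=> /mapP[y yt ->]; have [yl y0] : y != l /\ 0 < y.
    by apply: lr; apply/flatten_mapP; exists t.
  (* As [y] and [l] are positive and distinct, [f y] exceeds 1. *)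
  rewrite /f /= /unbump; move: yl y0 l_pos; lia.
- by rewrite /= cu; apply/allP.
Qed.

(** The leaf 1 lies in the first child at every level, and on labels above 1 the two shifts
    cancel. *)
Lemma unblossom_blossoming1 t : canonical P t -> all (leq 1) (leaves t) ->
  1 \in leaves t -> unblossom (blossoming 1 t) = t.
Proof.
elim/tree_ind_seq: t => [k|d [|u us] IH] ct /allP pt lt //.
  by move: lt; rewrite /= inE => /eqP ->.
have cu := canonical_child ct (mem_head u us).
have pu x : x \in leaves u -> 0 < x by move=> xu; apply: pt; rewrite /= mem_cat xu.
have mu : 0 < min_leaf u by apply/pu/min_leaf_in/(canonical_leaves P_prime cu).
have /allP lt_u := canonical_cons P_prime ct.
have lu : 1 \in leaves u.
  by move: lt; rewrite /= mem_cat => /orP[//|/lt_u /=]; rewrite ltnS leqNgt mu.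
rewrite /= lu /= drop0 star_decorationK IH ?mem_head //; last exact/allP.
congr (Node _ (_ :: _)); rewrite -map_comp -[RHS]map_id.
apply/eq_in_map => t tus; rewrite /= map_leaves_comp map_leaves_id // => x xt.
have /lt_u /= : x \in flatten (map leaves us) by apply/flatten_mapP; exists t.
by rewrite /unbump; move: mu; lia.
Qed.

Lemma md_tree_labels t : md_tree P t ->
  [/\ uniq (leaves t), all (leq 1) (leaves t) & {subset leaves t <= iota 1 (Defs.tsize t)}].
Proof.
move=> [_ pt]; split; first by rewrite (perm_uniq pt) iota_uniq.
  by apply/allP => x; rewrite (perm_mem pt) mem_iota => /andP[].
by move=> x; rewrite (perm_mem pt).
Qed.

Lemma md_tree_has1 t : md_tree P t -> 1 \in leaves t.
Proof.
move=> [ct pt]; rewrite (perm_mem pt) mem_iota /= add1n ltnS.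
by have := canonical_leaves P_prime ct; rewrite /Defs.tsize; case: (leaves t).
Qed.

Lemma md_tree_blossoming l t : md_tree P t -> l \in leaves t ->
  md_tree P (unblossom (blossoming l t)).
Proof.
move=> mt lt; have [ut pt st] := md_tree_labels mt; case: mt => ct pet.
have [cu pu] := canonical_blossoming ct ut pt lt.
split=> //; rewrite /Defs.tsize (perm_size pu) size_map.
apply: perm_trans pu _; apply: perm_trans (perm_map _ pet) _.
by apply: perm_move_to1; have := st l lt; rewrite mem_iota add1n ltnS.
Qed.

(** For the converse, [unblossom b] is blossomed at its leaf 1; this single label therefore reaches
    every blossomed tree. *)
Lemma blossomedE b : blossomed P b <-> md_tree P (unblossom b).
Proof.
split=> [[t [l [mt lt ->]]]|mb]; first exact: md_tree_blossoming.
exists (unblossom b), 1; split=> //; first exact: md_tree_has1.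
apply: unblossom_inj; rewrite unblossom_blossoming1 //; first by case: mb.
  by have [] := md_tree_labels mb.
exact: md_tree_has1.
Qed.

(** [unblossom] adds exactly one leaf, and a shift of the size by one differentiates an exponential
    generating function. *)
Lemma egf_blossomed (Q : pred tree) :
  egf bsize [set b | blossomed P b /\ Q (unblossom b)]
  = fps_deriv (tree_egf [set t | canonical P t /\ Q t]).
Proof.
apply: fpsP => n; rewrite fps_deriv_tree_egfE /= -/(ncard _).
congr (_%:R / _)%R.
have K t : md_tree P t -> unblossom (blossoming 1 t) = t.
  move=> mt; have [_ pt _] := md_tree_labels mt.
  by apply: unblossom_blossoming1 (md_tree_has1 mt) => //; case: mt.
have md t : canonical P t -> perm_eq (leaves t) (iota 1 n.+1) -> md_tree P t.
  by move=> ct pt; split=> //; rewrite /Defs.tsize (perm_size pt) size_iota.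
apply: (ncard_bij (f := blossoming 1) (g := unblossom)).
- by apply: (sub_locally_finite P_prime) => t [].
- move=> t [[ct Qt] pt]; have mt := md t ct pt; split.
    by split; rewrite ?K //; apply/blossomedE; rewrite K.
  apply: succn_inj; rewrite -tsize_unblossom K //.
  by rewrite /Defs.tsize (perm_size pt) /= size_iota.
- move=> b [[/blossomedE[cb pb] Qb] bn]; split=> //.
  by rewrite tsize_unblossom bn in pb.
- by move=> t [[ct _] pt]; apply/K/md.
- by move=> b [[/blossomedE mb _] _]; apply/unblossom_inj/K.
Qed.

(** * Constant terms and the exponential formula *)

Lemma leaves_nil_forests ts : forest P ts -> leaves (Node Oplus ts) = [::] -> ts = [::].
Proof.
move=> /and3P[_ /allP cts _] l0; have : size ts <= size (leaves (Node Oplus ts)).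
  by apply: leq_size_leaves => t /cts; apply: canonical_leaves.
by rewrite l0 leqn0 => /nilP.
Qed.

Lemma tree_egf_forests0 : tree_egf (forests P) 0 = 1%R.
Proof.
rewrite tree_egfE (ncard_uniq (s := [:: Node Oplus [::]])) ?divr1 //= => t.
rewrite inE; split=> [[[ts -> fts] pts]|/eqP ->].
  by rewrite (leaves_nil_forests fts) //; apply/nilP; rewrite /nilp (perm_size pts).
by split=> //; exists [::].
Qed.

Lemma tree_egf_notoplus0 : tree_egf (notoplus P) 0 = 0%R.
Proof.
rewrite tree_egfE (ncard_uniq (s := [::])) ?mul0r // => t; split=> // -[[ct _] pt].
by have := canonical_leaves P_prime ct; rewrite -size_eq0 (perm_size pt).
Qed.

Lemma tree_egf_forestsE : tree_egf (forests P) = fps_exp (tree_egf (notoplus P)).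
Proof.
apply: fps_exp_eq; [exact: tree_egf_notoplus0 | exact: tree_egf_forests0 |].
exact: forests_deriv.
Qed.

Lemma canonical_is_leaf t : canonical P t -> is_leaf t = (size (leaves t) == 1).
Proof.
case: t => // d ts ct; have := canonical_arity P_prime ct.
have : size ts <= size (leaves (Node d ts)).
  apply: leq_size_leaves => t tts.
  exact/(canonical_leaves P_prime)/(canonical_child ct).
by move=> le_ts /leq_trans /(_ le_ts); case: eqP => // ->.
Qed.

(** The tree reduced to a leaf has size 1 and adds 1 to the derivative. It corresponds to the lone
    blossom, whose exclusion gives the term [- 1] in the third identity. *)
Lemma fps_deriv_tree_egf_leaf (Q : pred tree) : (forall l, Q (Leaf l)) ->
  fps_deriv (tree_egf [set t | canonical P t /\ Q t])
  = (fps_deriv (tree_egf [set t | canonical P t /\ Q t && ~~ is_leaf t]) + 1)%R.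
Proof.
move=> QL; apply: fpsP => n; rewrite coeffD coeff1 !fps_deriv_tree_egfE.
(* Coefficient 0 of the derivative counts trees with one leaf, that is, only [Leaf 1]. *)
case: n => [|n].
  rewrite (ncard_uniq (s := [:: Leaf 1])) //; last first.
    move=> t; rewrite inE; split=> [[[ct _] pt]|/eqP ->]; last by split.
    have := canonical_is_leaf ct; rewrite (perm_size pt).
    case: t {ct} pt => // l /perm_mem/(_ l); rewrite !inE eqxx.
    by move=> /esym/eqP ->.
  rewrite (ncard_uniq (s := [::])) // ?mul0r ?add0r ?divr1 // => t; split=> //.
  by move=> [[ct /andP[_]]] + pt; rewrite (canonical_is_leaf ct) (perm_size pt).
rewrite addr0; congr ((ncard _)%:R / _)%R; apply/seteqP; split=> t [[ct]].
  move=> Qt pt; split=> //; split=> //.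
  by rewrite Qt (canonical_is_leaf ct) (perm_size pt) size_iota.
by move=> /andP[Qt _] pt.
Qed.

End Blossoms.

(** * The three identities *)

Local Open Scope ring_scope.

Theorem theorem4p10 (P : set lgraph)
    (P_prime : forall H : lgraph, P H -> prime_graph (tagged H))
    (P_stable : relabeling_stable P) :
  [/\ Toplus P = fps_deriv (T P) * fps_exp (- T_notoplus P),
      Tominus_notoplus P = Toplus P / fps_exp (T_notoplus P)
    & Toplus_notoplus P = (Toplus P - 1) / fps_exp (T_notoplus P)].
Proof.
have TF : T_notoplus P = tree_egf (notoplus P).
  by congr egf; apply/seteqP; split=> t [[]].
have F0 : T_notoplus P 0%N = 0 by rewrite TF tree_egf_notoplus0.
have forestE : tree_egf (forests P) = fps_exp (T_notoplus P).
  by rewrite tree_egf_forestsE // TF.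
have blossomE := egf_blossomed P_prime P_stable.
have eq_egf (A B : set btree) : (forall b, A b <-> B b) -> egf bsize A = egf bsize B.
  by move=> AB; congr egf; apply/seteqP; split=> b /AB.
have ToplusE : Toplus P
    = fps_deriv (tree_egf [set t | canonical P t /\ ~~ lparent (@is_oplus _) t]%classic).
  rewrite -blossomE; apply: eq_egf => b /=.
  by rewrite oplus_replaceableE.
have TominusE : Tominus_notoplus P = fps_deriv (tree_egf
    [set t | [/\ canonical P t, ~~ root_oplus t & ~~ lparent (@is_ominus _) t]]%classic).
  transitivity (fps_deriv (tree_egf [set t | canonical P t /\
      ~~ root_oplus t && ~~ lparent (@is_ominus _) t]%classic)).
    rewrite -blossomE; apply: eq_egf => b /=.
    rewrite ominus_replaceableE root_oplus_unblossom.
    by split=> [[? -> ->]|[? /andP[]]].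
  congr (fps_deriv (tree_egf _)); apply/seteqP; split=> t /=.
    by move=> [? /andP[]].
  by move=> [? -> ->].
have ToplusnE : Toplus_notoplus P = fps_deriv (tree_egf
    [set t | [/\ canonical P t, ~~ root_oplus t
               & ~~ lparent (@is_oplus _) t && ~~ is_leaf t]]%classic).
  transitivity (fps_deriv (tree_egf [set t | canonical P t /\
      [&& ~~ root_oplus t, ~~ lparent (@is_oplus _) t & ~~ is_leaf t]]%classic)).
    rewrite -blossomE; apply: eq_egf => b /=.
    rewrite oplus_replaceableE root_oplus_unblossom.
    (* [Blossom] is the only value of [btree] that [unblossom] sends to a leaf. *)
    split=> [[? -> -> bN]|[? /and3P[-> -> bN]]]; split=> //.
      by apply/negP => /is_leaf_unblossom.
    by move=> bB; rewrite bB in bN.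
  congr (fps_deriv (tree_egf _)); apply/seteqP; split=> t /=.
    by move=> [? /andP[]].
  by move=> [? -> ->].
rewrite fps_invexp //; split.
(* By definition [T P] is the series of the class of all canonical trees. *)
- rewrite ToplusE [fps_deriv (T P)](graft_decomposition P_prime) forestE.
  by rewrite -mulrA fps_expK // mulr1.
(* After the exchange of signs, [Toplus P] concerns trees whose leftmost leaf has no ominus parent,
   a condition insensitive to the removal of an oplus root. *)
- rewrite ToplusE -tree_egf_swap // TominusE root_decomposition //.
  + by rewrite forestE -mulrA fps_expK // mulr1.
  + by move=> f t; rewrite lparent_map.
  + by move=> x ts; rewrite lparent_cons; case: x.
(* Subtracting 1 removes the single leaf. The condition then passes through an oplus root: such a
   root directly above the leftmost leaf fails it, just as the leaf alone does. *)
rewrite ToplusE fps_deriv_tree_egf_leaf // addrK ToplusnE root_decomposition //.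
- by rewrite forestE -mulrA fps_expK // mulr1.
- by move=> f t; rewrite lparent_map; case: t.
- by move=> x ts; rewrite lparent_cons; case: x => //=; rewrite ?andbT ?andbF.
Qed.
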